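(* Let $(W,S)$ be a finite Coxeter system and let $k$ be a field of characteristic $q$ (either $q=0$ or $q>0$). Let $\mathscr{D}_k$ be the descent algebra of $W$ over $k$, and let $e_J\in\mathscr{D}_k$ $(J\in\mathcal{R}_q)$ be the elements constructed in the context. Then $\{e_J:J\in\mathcal{R}_q\}$ is a complete set of orthogonal primitive idempotents of $\mathscr{D}_k$ such that $\theta_k(e_J)=\mathrm{char}_{J,k}$ for each $J\in\mathcal{R}_q$ and $\sum_{J\in\mathcal{R}_q}e_J=1$. Furthermore, for each $J\in\mathcal{R}_q$, $$e_J=\tfrac{1}{\gamma_J}x_J+\epsilon_J,$$ where $\epsilon_J$ is a linear combination of elements $x_K$ with $K\subsetneq_W J$, with coefficients belonging to the prime subfield of $k$.
   Context: Descent algebra: for $J\subseteq S$ let $W_J=\langle J\rangle$, $X_J=\{w\in W:\ell(ws)>\ell(w)\text{ for all }s\in J\}$ ($\ell$ the length function) and $x_J=\sum_{w\in X_J}w\in\mathbb{Z}W$. The $\mathbb{Z}$-span $\mathscr{D}_{\mathbb{Z}}$ of $\{x_J:J\subseteq S\}$ is a subalgebra of $\mathbb{Z}W$ with $\mathbb{Z}$-basis $\{x_J\}$ (Solomon), and $\mathscr{D}_k=k\otimes_{\mathbb{Z}}\mathscr{D}_{\mathbb{Z}}$, with $k$-basis $\{x_J:J\subseteq S\}$. Conjugacy: for $J,K\subseteq S$ write $J\subseteq_W K$ (resp. $J=_W K$) if $wJw^{-1}\subseteq K$ (resp. $wJw^{-1}=K$) for some $w\in W$, and $J\subsetneq_W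 K$ if $J\subseteq_W K$ but not $J=_W K$. Let $\mathcal{R}$ be a set of representatives of the $=_W$-classes of subsets of $S$, with a fixed total order $\leq$ such that $J\subseteq_W K$ implies $J\leq K$ for $J,K\in\mathcal{R}$. The map $\theta_k$: $\varphi_J$ is the permutation character of $W$ on $W/W_J$, and $\varphi_J^k=\varphi_J\cdot 1_k$ is the corresponding $k$-valued function on $W$. The map $\theta_k:x_J\mapsto\varphi_J^k$ extends to a $k$-algebra homomorphism from $\mathscr{D}_k$ to the $k$-valued functions on $W$, whose kernel is $\operatorname{Rad}(\mathscr{D}_k)$. Let $c_K$ be a Coxeter element of $W_K$ (product of all elements of $K$ in some order). Let $\beta_{JK}=\varphi_J(c_K)$; one has $\beta_{JJ}=[N_W(W_J):W_J]$. Let $\mathcal{R}_q=\{J\in\mathcal{R}:\beta_{JJ}\neq 0\text{ in }k\}$ (so $\mathcal{R}_0=\mathcal{R}$) and $\gamma_J=\beta_{JJ}\cdot 1_k$ for $J\in\mathcal{R}_q$. The matrix $M_k=(\beta_{JK}\cdot 1_k)_{J,K\in\mathcal{R}_q}$ is invertible; write $M_k^{-1}=(b_{JK})$. For $J\in\mathcal{R}_q$, $\mathrm{char}_{J,k}$ denotes the element of $\operatorname{im}\theta_k$ with value $1$ at $c_J$ and $0$ at $c_K$ for $J\neq K\in\mathcal{R}_q$ (elements of $\operatorname{im}\theta_k$ are determined by their values at the $c_K$, $K\in\mathcal{R}_q$). Construction of $e_J$: put $f_J=\sum_{K\in\mathcal{R}_q}b_{JK}x_K\in\mathscr{D}_k$.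 Write $\mathcal{R}_q=\{J_1<J_2<\dots<J_m\}$, $f_i=f_{J_i}$, $f_{\ge i}=\sum_{j\ge i}f_j$. For $a\in\mathscr{D}_k$ whose image modulo $\operatorname{Rad}(\mathscr{D}_k)$ is idempotent, let $a_1=a$, $a_{r+1}=3a_r^2-2a_r^3$; this sequence is eventually constant, equal to an idempotent denoted $(a)_\infty$. Define $f_1'=1$, $f_i'=(f_{i-1}'f_{\ge i}f_{i-1}')_\infty$ for $2\le i\le m$ (the element in brackets is idempotent modulo the radical), $f_{m+1}'=0$, and $e_{J_i}=f_i'-f_{i+1}'$ for $1\le i\le m$. *)

(* Defs.v *)
From HB Require Import structures.
From mathcomp Require Import all_boot all_order all_fingroup all_algebra.
From mathcomp Require Import classical_sets.

Set Implicit Arguments.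
Unset Strict Implicit.
Unset Printing Implicit Defensive.

Import GroupScope GRing.Theory.

Local Open Scope ring_scope.

(* W is presented by the generators S and the relations (s t)^m(s,t) = 1,
   m(s,t) being the order of s t; the presentation is expressed by its
   universal property among all (possibly infinite) groups.  The case s = t
   gives the relations s^2 = 1. *)
Definition coxeter_system (W : finGroupType) (S : {set W}) : Prop :=
  [/\ <<S>>%g = [set: W],
      {in S, forall s, #[s]%g = 2%N} &
      forall (H : groupType) (f : W -> H),
        {in S &, forall s t, ((f s * f t) ^+ #[s * t] = 1)%g} ->
        exists phi : W -> H,
          {morph phi : x y / (x * y)%g} /\ {in S, phi =1 f}].

Section Descent.

Variables (W : finGroupType) (S : {set W}).

Definition has_word (w : W) (n : nat) : bool :=
  [exists t : n.-tuple W,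
     all (fun s => s \in S) t && ((\prod_(s <- t) s)%g == w)].

(* Reduced words have fewer than #|W| letters, since their prefixes have
   distinct products: bounding the search loses nothing when S generates W. *)
Definition len (w : W) : nat := find (has_word w) (iota 0 #|W|).

Definition subS := {J : {set W} | J \subset S}.

Definition X_ (J : subS) : {set W} :=
  [set w | [forall s in val J, (len w < len (w * s)%g)%N]].

(* The group ring ZW, as integer-valued functions with convolution. *)
Definition ZW := {ffun W -> int}.

Definition zw_of (w : W) : ZW := [ffun u => (u == w)%:R].

Definition zw_mul (a b : ZW) : ZW :=
  [ffun w => \sum_(u : W) a u * b (u^-1 * w)%g].

Definition zx (J : subS) : ZW := \sum_(w in X_ J) zw_of w.

(* Coordinates, in the Z-basis (x_J) of D_Z, of an element of D_Z. *)
Definition zcoord (a : ZW) : {ffun subS -> int} :=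
  xget 0 (fun c : {ffun subS -> int} => a = \sum_J zx J *~ c J).

(* wJw^-1 is J :^ w^-1 in the library's convention for conjugation. *)
Definition conj_subset (J K : subS) : bool :=
  [exists w : W, (val J :^ w^-1)%g \subset val K].

Definition conj_eq (J K : subS) : bool :=
  [exists w : W, (val J :^ w^-1)%g == val K].

Definition conj_proper (J K : subS) : bool :=
  conj_subset J K && ~~ conj_eq J K.

Definition is_representatives (R : {set subS}) : Prop :=
  forall J : subS, exists! K : subS, K \in R /\ conj_eq J K.

Definition compatible_total_order (R : {set subS}) (le : rel subS) : Prop :=
  [/\ {in R &, total le}, {in R &, antisymmetric le},
      {in R & &, transitive le} &
      {in R &, forall J K, conj_subset J K -> le J K}].

Definition coxeter_element (K : subS) (w : W) : Prop :=
  exists2 s : seq W, perm_eq s (enum (val K)) & w = (\prod_(x <- s) x)%g.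

(* Number of left cosets of W_J fixed by w under left translation. *)
Definition perm_char (J : subS) (w : W) : nat :=
  #|[set C in lcosets <<val J>> [set: W] | (w *: C)%g == C]|.

Section OverField.

Variable k : fieldType.

(* D_k = k \otimes D_Z, in coordinates with respect to the basis (x_J); its
   structure constants are the images in k of those of D_Z. *)
Definition descent := {ffun subS -> k^o}.

(* a |-> 1 \otimes a *)
Definition base_change (a : ZW) : descent := [ffun J => (zcoord a J)%:~R].

Definition dx (J : subS) : descent := [ffun K => (K == J)%:R].

Definition d1 : descent := base_change (zw_of 1%g).

Definition dmul (a b : descent) : descent :=
  \sum_J \sum_K (a J * b K) *: base_change (zw_mul (zx J) (zx K)).

Definition theta (a : descent) : {ffun W -> k} :=
  [ffun w => \sum_J a J * (perm_char J w)%:R].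

Definition didempotent (a : descent) : Prop := dmul a a = a.

Definition dorthogonal (a b : descent) : Prop :=
  dmul a b = 0 /\ dmul b a = 0.

Definition dprimitive (a : descent) : Prop :=
  [/\ didempotent a, a <> 0 &
      forall b c : descent, didempotent b -> didempotent c ->
        dorthogonal b c -> a = b + c -> b = 0 \/ c = 0].

Definition complete_orthogonal_primitive
    (A : {set subS}) (e : subS -> descent) : Prop :=
  [/\ {in A, forall J, dprimitive (e J)},
      {in A &, forall J K, J != K -> dorthogonal (e J) (e K)} &
      \sum_(J in A) e J = d1].

Definition dstep (a : descent) : descent :=
  dmul a a *+ 3 - dmul (dmul a a) a *+ 2.

(* The eventual value of a, dstep a, dstep (dstep a), ... *)
Definition dinfty (a : descent) : descent :=
  xget 0 (fun b => exists N, forall r, (N <= r)%N -> iter r dstep a = b).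

Definition in_prime_subfield (x : k) : Prop :=
  forall F : {pred k}, GRing.divring_closed F -> x \in F.

Section Construction.

Variables (R : {set subS}) (le : rel subS) (c : subS -> W).

Definition beta (J K : subS) : nat := perm_char J (c K).

Definition Rq : {set subS} := [set J in R | (beta J J)%:R != 0 :> k].

Definition gamma (J : subS) : k := (beta J J)%:R.

(* The unique element of the image of theta with the prescribed values. *)
Definition char_ (J : subS) : {ffun W -> k} :=
  xget 0 (fun chi => [/\ exists a, chi = theta a, chi (c J) = 1 &
                         {in Rq, forall K, K != J -> chi (c K) = 0}]).

(* J_1 < ... < J_m; positions are counted from 0 below. *)
Definition Rq_seq : seq subS := sort le (enum Rq).

Definition mq := size Rq_seq.

Definition Rq_nth (i : 'I_mq) : subS := tnth (in_tuple Rq_seq) i.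

Definition Mk : 'M[k]_mq := \matrix_(i, j) (beta (Rq_nth i) (Rq_nth j))%:R.

Definition f_ (i : 'I_mq) : descent :=
  \sum_(j < mq) invmx Mk i j *: dx (Rq_nth j).

Definition f_ge (i : nat) : descent := \sum_(j < mq | (i <= j)%N) f_ j.

Fixpoint f_prime (i : nat) : descent :=
  if i is i'.+1 then
    if (i < mq)%N then
      dinfty (dmul (dmul (f_prime i') (f_ge i)) (f_prime i'))
    else 0
  else d1.

Definition e_ (J : subS) : descent :=
  let i := index J Rq_seq in f_prime i - f_prime i.+1.

End Construction.
End OverField.
End Descent.

(* Main.v *)
(* The Coxeter relations make the maps (t, e) |-> (s t s, e + [t = s]) act on
   W x {0, 1}; the second component is a cocycle n with n(w, s) = 1 iff ws < w,
   and all that is needed on parabolic subgroups follows from it, in particular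
   Solomon's formula x_J x_K = sum over d in X_J^-1 :&: X_K of
   x_(K :&: d^-1 W_J d).  So left multiplication by a in D_k is triangular in
   the basis (x_K), with diagonal entries theta(a)(c_K): the maps
   a |-> theta(a)(c_K) are characters of D_k, and an element killed by all of
   them is nilpotent.  When beta_KK = 0 in k, a Sylow q-subgroup Q of N(W_K)
   is not contained in W_K, and counting the fixed points of Q shows that the
   character of K is that of a larger parabolic subgroup, the closure of
   <W_K, Q>; hence the characters indexed by R_q suffice.
   Since sum_i f_i = 1, the idempotent e_i is the limit of the iteration started
   at g (f_1 + ... + f_i) g with g = f'_i.  Modulo the ideal spanned by the x_K
   with K conjugate into J_i this element is nilpotent, so e_i lies in that
   ideal; modulo the x_K with K conjugate properly into J_i or into some J_j,
   j < i, it is x_(J_i) / gamma_(J_i). *)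

From HB Require Import structures.
Require Import Defs.
From mathcomp Require Import all_boot all_order all_fingroup all_algebra.
From mathcomp Require Import all_solvable ring.
From mathcomp Require classical_sets boolp.

Set Implicit Arguments.
Unset Strict Implicit.
Unset Printing Implicit Defensive.

Import GroupScope GRing.Theory.

(** * Words and the inversion cocycle *)

Section Words.

Variable W : finGroupType.
Implicit Types (A J : {set W}) (w x y : W) (p q : seq W).

Lemma gen_wordP A w :
  reflect (exists2 p, {subset p <= A} & w = \prod_(s <- p) s) (w \in <<A>>).
Proof.
apply: (iffP idP) => [/gen_prodgP[n [c cA ->]] | [p pA ->]].
  exists [seq c i | i <- index_enum 'I_n]; first by move=> _ /mapP[i _ ->].
  by rewrite big_map.
elim: p pA => [|s p IHp] pA; first by rewrite big_nil group1.
rewrite big_cons groupM ?IHp ?mem_gen ?pA ?mem_head // => t tp.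
by rewrite pA // inE tp orbT.
Qed.

Lemma has_wordP A w n :
  reflect (exists p, [/\ size p = n, {subset p <= A} & w = \prod_(s <- p) s])
          (has_word A w n).
Proof.
apply: (iffP existsP) => [[t /andP[/allP tA /eqP <-]] | [p [<- pA ->]]].
  by exists t; rewrite size_tuple.
by exists (in_tuple p); rewrite eqxx andbT; apply/allP.
Qed.

(** Cutting out the letters between two equal prefix products shortens a word, so a shortest word
    has distinct prefix products and fewer than [#|W|] letters. Hence the bounded search in [len]
    succeeds. *)
Lemma short_word A w :
  w \in <<A>> -> exists2 n, (n < #|W|)%N & has_word A w n.
Proof.
case/gen_wordP=> p0 p0A w0.
have exw : exists n, has_word A w n.
  by exists (size p0); apply/has_wordP; exists p0.
case: (ex_minnP exw) => n /has_wordP[p [<- pA wE]] min_n.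
exists (size p); last by apply/has_wordP; exists p.
pose f i := \prod_(s <- take i p) s.
have f_inj : {in iota 0 (size p).+1 &, injective f}.
  have main i j : (i < j <= size p)%N -> f i <> f j.
    case/andP=> lt_ij le_jp eq_f.
    have /min_n : has_word A w (size (take i p ++ drop j p)).
      apply/has_wordP; exists (take i p ++ drop j p); split=> //.
        by move=> s; rewrite mem_cat => /orP[/mem_take|/mem_drop]; apply: pA.
      by rewrite big_cat /= -/(f i) eq_f -big_cat cat_take_drop.
    rewrite size_cat size_drop size_takel; last exact: leq_trans (ltnW lt_ij) _.
    by rewrite leqNgt -{2}(subnKC le_jp) ltn_add2r lt_ij.
  move=> i j; rewrite !mem_iota !add0n !ltnS => /= le_i le_j eq_f.
  case: (ltngtP i j) => // lt_ij.
    by case: (main i j); rewrite ?lt_ij.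
  by case: (main j i); rewrite ?lt_ij.
have := map_inj_in_uniq f_inj; rewrite iota_uniq => /card_uniqP.
by rewrite size_map size_iota => <-; apply: max_card.
Qed.

End Words.

Section Coxeter.

Variables (W : finGroupType) (S : {set W}).
Hypothesis hS : coxeter_system S.
Implicit Types (s t u w x y d : W) (p q : seq W) (I J K : {set W}).

Lemma simple_invol s : s \in S -> s * s = 1.
Proof.
case: hS => _ S2 _ sS.
by rewrite -[_ * _]/(s ^+ 2) -(S2 s sS) expg_order.
Qed.

Lemma simpleV s : s \in S -> s^-1 = s.
Proof. by move=> sS; apply/eqP; rewrite eq_invg_mul simple_invol. Qed.

Lemma simple_gen w : w \in <<S>>.
Proof. by case: hS => -> _ _; rewrite inE. Qed.

Lemma conj_selfV x : x ^ x^-1 = x.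
Proof. by rewrite conjgE mulgV mulg1 invgK. Qed.

Lemma conj_simple_eq s x y : s \in S -> (x ^ s == y) = (x == s * y * s).
Proof.
move=> sS; apply/eqP/eqP => [<- | ->].
  by rewrite conjgE !mulgA mulgV mul1g -mulgA simple_invol ?mulg1.
by rewrite conjgE simpleV // -!mulgA simple_invol // mulg1 mulgA simple_invol
  ?mul1g.
Qed.

(** The classical action on reflections with signs, except that the first component runs over all of
    W. *)
Definition flip s (a : W * bool) : W * bool := (a.1 ^ s, a.2 (+) (a.1 == s)).

Lemma flip_inj s : injective (flip s).
Proof. by case=> [r b] [r' b'] [/conjg_inj<- /addIb->]. Qed.

(** The n-th power of the product adds to the bit the number of i < 2n with r = (s t)^i s. When n is
    the order of s t, every solution is counted twice and the bit is unchanged. *)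
Lemma flip_relation s t : s \in S -> t \in S ->
  (perm (@flip_inj s) * perm (@flip_inj t)) ^+ #[s * t] = 1.
Proof.
move=> sS tS; set m := #[s * t]; set P := perm _ * perm _.
pose g j (r : W) := \sum_(0 <= i < j) nat_of_bool (r == (s * t) ^+ i * s)%g.
have step r b : P (r, b) =
    (r ^ (s * t), b (+) odd ((r == s) + (r == (s * t) * s))).
  rewrite permM !permE /flip /= -conjgM oddD !oddb addbA; congr (_, _ (+) _).
  by rewrite conj_simple_eq.
have power r b n : (P ^+ n) (r, b) = (r ^ ((s * t) ^+ n), b (+) odd (g n.*2 r)).
  elim: n r b => [|n IHn] r b.
    by rewrite expg0 perm1 /g big_nil addbF conjg1.
  rewrite expgS permM step IHn -conjgM -expgS; congr (_, _).
  rewrite -addbA -oddD; congr (_ (+) odd _).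
  rewrite /g doubleS !big_nat_recl //= expg0 mul1g expg1 addnA; congr addn.
  apply: eq_big_nat => i _; congr nat_of_bool.
  rewrite conjgM !conj_simple_eq //; congr (_ == _).
  by rewrite (expgS _ i.+1) expgSr !mulgA.
apply/permP=> -[r b]; rewrite power perm1 expg_order conjg1.
suff -> : odd (g m.*2 r) = false by rewrite addbF.
rewrite /g -addnn (big_cat_nat (n := m)) ?leq_addr //=.
rewrite -{2}[m]add0n big_addn addnK.
have -> : \sum_(0 <= i < m) nat_of_bool (r == (s * t) ^+ (i + m) * s)%g
        = \sum_(0 <= i < m) nat_of_bool (r == (s * t) ^+ i * s)%g.
  by apply: eq_bigr => i _; rewrite expgD expg_order mulg1.
by rewrite addnn odd_double.
Qed.

(* The permutations flip s of W x {0, 1} satisfy the Coxeter relations, hence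
   define an action of W; its second component is a cocycle. *)
Lemma inversion_cocycle : exists n : W -> W -> bool,
  (forall x y t, n (x * y) t = n y t (+) n x (t ^ y^-1)) /\
  {in S, forall s t, n s t = (t == s)}.
Proof.
have [phi [phiM phiS]] : exists phi : W -> {perm W * bool},
    {morph phi : x y / x * y} /\ {in S, phi =1 fun s => perm (@flip_inj s)}.
  by case: hS => _ _; apply; apply: flip_relation.
pose N x r := (phi x (r, false)).2.
have phiE x r b : phi x (r, b) = (r ^ x, b (+) N x r).
  have /gen_wordP[p pS ->] := simple_gen x; rewrite {x}.
  elim: p pS r b => [_|s p IHp pS] r b.
    have phi1 : phi 1 = 1.
      by apply: (mulgI (phi 1)); rewrite -phiM !mulg1.
    by rewrite /N big_nil phi1 !perm1 conjg1 addbF.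
  have sS : s \in S by rewrite pS ?mem_head.
  have pS' : {subset p <= S} by move=> t tp; rewrite pS // inE tp orbT.
  rewrite /N big_cons phiM !permM (phiS s sS) /= !permE /flip /= !(IHp pS')
    conjgM.
  by rewrite addbA.
(* [N] records left inversions, since permutations compose from left to right; inverting x turns
   them into right inversions. *)
exists (fun x r => N x^-1 r); split=> [x y t | s sS t].
  have := phiE (y^-1 * x^-1) t false; rewrite phiM permM invMg !phiE.
  by case=> _ <-.
by rewrite /N simpleV // phiS //= permE.
Qed.

Definition inv w t : bool := sval (boolp.cid inversion_cocycle) w t.

Lemma invM x y t : inv (x * y) t = inv y t (+) inv x (t ^ y^-1).
Proof. exact: (svalP (boolp.cid inversion_cocycle)).1. Qed.

Lemma inv_simple s t : s \in S -> inv s t = (t == s).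
Proof. by move=> sS; apply: (svalP (boolp.cid inversion_cocycle)).2. Qed.

Lemma inv1 t : inv 1 t = false.
Proof. by have := invM 1 1 t; rewrite mulg1 invg1 conjg1; case: inv. Qed.

Lemma invV w t : inv w^-1 t = inv w (t ^ w).
Proof.
by have := invM w w^-1 t; rewrite mulgV inv1 invgK; do 2!case: inv.
Qed.

(** Strong exchange. For a word s y, the cocycle rule makes t either an inversion of y, where
    induction applies, or such that y t y^-1 = s, and then s y t = y. *)
Lemma inv_exchange p t : {subset p <= S} -> inv (\prod_(s <- p) s) t ->
  exists q, [/\ (size q < size p)%N, {subset q <= p}
                & \prod_(s <- q) s = \prod_(s <- p) s * t].
Proof.
elim: p => [|s p IHp] pS; first by rewrite big_nil inv1.
have sS : s \in S by rewrite pS ?mem_head.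
have pS' : {subset p <= S} by move=> r rp; rewrite pS // inE rp orbT.
rewrite big_cons invM; have [/(IHp pS')[q [lt_q qp qE]] _ | _] :=
  boolP (inv _ t).
  exists (s :: q); split=> //; last by rewrite big_cons qE mulgA.
  by move=> r; rewrite !inE => /orP[-> // | /qp->]; rewrite orbT.
rewrite inv_simple //= => /eqP sE; exists p; split=> //.
  by move=> r rp; rewrite inE rp orbT.
have yt : \prod_(i <- p) i * t = s * \prod_(i <- p) i.
  by rewrite -sE conjgE invgK mulgA mulgKV.
by rewrite -mulgA yt mulgA simple_invol // mul1g.
Qed.

Notation len := (len S).

Lemma lenP w : has_word S w (len w).
Proof.
have [n ltn wn] := short_word (simple_gen w).
have hasw : has (has_word S w) (iota 0 #|W|).
  by apply/hasP; exists n; rewrite ?mem_iota.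
have := nth_find 0%N hasw; rewrite nth_iota ?add0n //.
by move: hasw; rewrite has_find size_iota.
Qed.

Lemma len_min w n : has_word S w n -> (len w <= n)%N.
Proof.
move=> wn; rewrite leqNgt; apply/negP => lt_n.
have := before_find 0%N lt_n; rewrite nth_iota ?add0n ?wn //.
by apply: leq_trans lt_n _; rewrite /len -{2}(size_iota 0 #|W|) find_size.
Qed.

Lemma len_inv w t : inv w t -> (len (w * t) < len w)%N.
Proof.
have /has_wordP[p [<- pS ->]] := lenP w => /(inv_exchange pS)[q [lt_q qp <-]].
apply: leq_ltn_trans lt_q; apply: len_min; apply/has_wordP; exists q.
by split=> // s /qp/pS.
Qed.

Lemma len_simple w s : s \in S -> (len w < len (w * s))%N = ~~ inv w s.
Proof.
move=> sS; have [ws | nws] /= := boolP (inv w s).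
  by apply/negbTE; rewrite -leqNgt ltnW ?len_inv.
have := @len_inv (w * s) s; rewrite -mulgA simple_invol // mulg1; apply.
by rewrite invM inv_simple // conj_selfV eqxx (negbTE nws).
Qed.

(** Exchange only reuses letters of the given word, so u t is again a product of elements of J. *)
Lemma inv_gen J u t : J \subset S -> u \in <<J>> -> inv u t -> t \in <<J>>.
Proof.
move=> sJS Ju; have /gen_wordP[p pJ uE] := Ju; rewrite {1}uE.
case/inv_exchange=> [s /pJ/(subsetP sJS) // | q [_ qp]].
rewrite -uE => qE; rewrite -(groupMl _ Ju) -qE.
by apply/gen_wordP; exists q => // s /qp/pJ.
Qed.

(** The last letter s of a word is a descent unless s is already an inversion of the rest; in that
    case exchange gives a shorter word for the same element. *)
Lemma inv_descent J u : J \subset S -> u \in <<J>> -> u != 1 ->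
  exists2 s, s \in J & inv u s.
Proof.
move=> sJS /gen_wordP[p pJ ->]; have [n] := ubnP (size p).
elim: n p pJ => // n IHn p; case/lastP: p => [|p s] pJ;
  first by rewrite big_nil eqxx.
rewrite size_rcons ltnS => lt_pn p_neq1.
have sJ : s \in J by rewrite pJ // mem_rcons mem_head.
have pJ' : {subset p <= J} by move=> t tp; rewrite pJ // mem_rcons inE tp orbT.
have sS := subsetP sJS s sJ.
have pE : \prod_(i <- rcons p s) i = \prod_(i <- p) i * s.
  by rewrite -cats1 big_cat big_seq1.
have [ps | nps] := boolP (inv (\prod_(i <- p) i) s).
  have [t /pJ'/(subsetP sJS) // | q [lt_q qp qE]] := inv_exchange _ ps.
  rewrite pE -qE; apply: IHn; first by move=> t /qp/pJ'.
    exact: leq_trans lt_q (ltnW lt_pn).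
  by rewrite qE -pE.
by exists s => //; rewrite pE invM inv_simple // conj_selfV eqxx (negbTE nps).
Qed.

End Coxeter.

(** * Parabolic subgroups *)

Section Parabolic.

Variables (W : finGroupType) (S : {set W}).
Hypothesis hS : coxeter_system S.
Implicit Types (s t u v w x y d b : W) (I J K L : subS S).

Local Notation inv := (inv hS).
Local Notation len := (len S).
Local Notation P J := <<val J>>.

Lemma X_P J x : reflect {in val J, forall s, inv x s = false} (x \in X_ J).
Proof.
rewrite inE; apply: (iffP forall_inP) => xJ s sJ.
  by apply/negbTE; rewrite -len_simple ?xJ ?(subsetP (valP J)).
by rewrite (len_simple hS) ?xJ ?(subsetP (valP J)).
Qed.

(** Take a shortest element of w W_J: an inversion in W_J would lead to a shorter one in the same
    coset. *)
Lemma coset_min J w : exists x u, [/\ x \in X_ J, u \in P J, w = x * u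
  & forall t, t \in P J -> inv x t = false].
Proof.
have ww : w \in w *: P J by rewrite lcoset_refl.
case: (arg_minnP (fun x => len x) ww) => x xw min_x.
have xP t : t \in P J -> inv x t = false.
  move=> tJ; apply/negP => /len_inv.
  have /min_x : x * t \in w *: P J by rewrite -(lcoset_eqP xw) mem_lcoset mulKg.
  by rewrite leqNgt => /negP.
exists x, (x^-1 * w); split=> //; last by rewrite mulKVg.
  by apply/X_P => s sJ; rewrite xP ?mem_gen.
by rewrite -mem_lcoset lcoset_sym.
Qed.

Lemma X_min J x u : u \in P J -> (forall t, t \in P J -> inv x t = false) ->
  x * u \in X_ J -> u = 1.
Proof.
move=> uJ xP /X_P xuJ; apply/eqP/negPn/negP => u1.
have [s sJ us] := inv_descent hS (valP J) uJ u1.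
by have := xuJ s sJ; rewrite invM us xP // groupJ ?groupV // mem_gen.
Qed.

Lemma X_inv J x t : x \in X_ J -> t \in P J -> inv x t = false.
Proof.
have [y [u [_ uJ -> yP]]] := coset_min J x.
by move=> yuX; rewrite (X_min uJ yP yuX) mulg1; apply: yP.
Qed.

Lemma X_uniq J x y : x \in X_ J -> y \in X_ J -> x^-1 * y \in P J -> x = y.
Proof.
move=> xJ yJ uJ; apply/eqP; rewrite eq_mulVg1; apply/eqP/(@X_min J x) => //.
  by move=> t; apply: X_inv.
by rewrite mulKVg.
Qed.

Lemma inv_conj_simple d s t :
  s \in S -> inv d t = false -> inv (s * d) t = (t ^ d^-1 == s).
Proof. by move=> sS dt; rewrite invM dt inv_simple. Qed.

(** Deodhar's lemma: an inversion of s d that is not one of d can only be d^-1 s d. *)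
Lemma deodhar K d s : s \in S -> d \in X_ K -> s * d \notin X_ K ->
  s ^ d \in val K.
Proof.
move=> sS dK; apply: contraR => sdK; apply/X_P => t tK.
rewrite inv_conj_simple ?(X_inv dK) ?mem_gen //.
by apply: contraNF sdK => /eqP <-; rewrite conjgKV.
Qed.

Lemma left_split J b :
  exists u d, [/\ u \in P J, d^-1 \in X_ J & b = u * d].
Proof.
have [x [u [xJ uJ bE _]]] := coset_min J b^-1.
by exists u^-1, x^-1; rewrite groupV invgK -invMg -bE invgK.
Qed.

(** * Double coset representatives and intersections of parabolic subgroups *)

Definition double_reps J K : {set W} := [set d in X_ K | d^-1 \in X_ J].

(** A descent s of d in K must be cancelled in u d, so d s d^-1 is an inversion of u and lies in
    W_J; but it is also an inversion of d^-1, which is in X_J. *)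
Lemma double_repP J K u d : u \in P J -> d^-1 \in X_ J -> u * d \in X_ K ->
  d \in double_reps J K.
Proof.
move=> uJ dJ /X_P udK; rewrite inE dJ andbT; apply/X_P => s sK.
have := udK s sK; rewrite invM; have [ds /=|//] := boolP (inv d s).
move/negbFE/(inv_gen (valP J) uJ) => /(X_inv dJ).
by rewrite invV conjgKV ds.
Qed.

(** For [d] in [double_reps J K] this is also the intersection of K with d^-1 J d, by
    [meet_conj]. *)
Definition meet J K d : subS S :=
  exist _ (val K :&: P J :^ d) (subset_trans (subsetIl _ _) (valP K)).

Lemma meet_sub J K d : val (meet J K d) \subset val K.
Proof. exact: subsetIl. Qed.

Lemma mem_meet J K d t : (t \in val (meet J K d)) =
  (t \in val K) && (t ^ d^-1 \in P J).
Proof. by rewrite inE mem_conjg. Qed.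

Lemma simple_neq1 s : s \in S -> s != 1.
Proof.
move=> sS; apply/eqP => s1.
by have := inv_simple hS s sS; rewrite s1 (inv1 hS) eqxx.
Qed.

(** Let s in J be a descent of r = d t d^-1. Evaluating the cocycle of d^-1 r = t d^-1 at s in two
    ways forces t = d^-1 s d. *)
Lemma meet_conj J K d : d \in double_reps J K ->
  val (meet J K d) :^ d^-1 \subset val J.
Proof.
rewrite inE => /andP[dK dJ]; apply/subsetP => r /imsetP[t].
rewrite mem_meet => /andP[tK rJ] {r}->.
have tS := subsetP (valP K) t tK.
have r1 : t ^ d^-1 != 1 by rewrite conjg_eq1 simple_neq1.
have [s sJ rs] := inv_descent hS (valP J) rJ r1.
suff <- : s ^ d = t by rewrite conjgK.
have := invM hS d^-1 (t ^ d^-1) s; rewrite rs (X_inv dJ); last first.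
  by rewrite groupJ ?groupV // mem_gen.
rewrite conjgE invgK mulKg invM (inv_simple hS _ tS) invgK.
by rewrite (X_inv dJ) ?mem_gen //= => /eqP.
Qed.

(** Kilmoyer's theorem, by induction on length: if t in K is a descent of v, then d t d^-1 is an
    inversion of d v d^-1, so it lies in W_J and t can be split off. *)
Lemma meet_gen J K d : d \in double_reps J K ->
  P K :&: P J :^ d = P (meet J K d).
Proof.
rewrite inE => /andP[dK dJ]; apply/eqP; rewrite eqEsubset andbC.
rewrite gen_subG setISS ?subset_gen //=.
apply/subsetP => v; have [n] := ubnP (len v); elim: n v => // n IHn v.
rewrite ltnS => le_n /setIP[vK]; rewrite mem_conjg => vJ.
have [-> | v1] := eqVneq v 1; first exact: group1.
have [t tK vt] := inv_descent hS (valP K) vK v1.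
have tL : t \in val (meet J K d).
  rewrite mem_meet tK /=; apply: (inv_gen (valP J) vJ) => //.
  have := invM hS d v t; rewrite vt (X_inv dK) ?groupJ ?groupV // ?mem_gen //.
  have -> : d * v = v ^ d^-1 * d by rewrite conjgE invgK !mulgA mulgKV.
  by rewrite invM (X_inv dK) ?mem_gen.
have := tL; rewrite mem_meet => /andP[_ tJ].
rewrite -(mulgK t v) groupM ?groupV // ?(mem_gen tL) //; apply: IHn.
  exact: leq_trans (len_inv vt) le_n.
by apply/setIP; split; rewrite groupM ?(mem_gen tK) // mem_conjg.
Qed.

(* Write b = u d with u in W_J and d minimal in W_J b: if w b^-1 is in X_J,
   then u is the W_J-component of w d^-1, and b is in X_K iff w is in
   X_(meet J K d). *)
Lemma double_reps_count J K w :
  #|[set b in X_ K | w * b^-1 \in X_ J]| =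
  #|[set d in double_reps J K | w \in X_ (meet J K d)]|.
Proof.
have key x u d : x \in X_ J -> u \in P J -> d \in double_reps J K ->
    (u * d \in X_ K) = (x * u * d \in X_ (meet J K d)).
  move=> xJ uJ; rewrite inE => /andP[dK dJ].
  have main s : s \in val K -> s ^ d^-1 \in P J ->
      inv (x * u * d) s = inv (u * d) s.
    move=> sK sJ; rewrite !invM !(X_inv dK) ?mem_gen //=.
    by rewrite (X_inv xJ) ?addbF // groupJ ?groupV.
  apply/X_P/X_P => [udK s | udK s sK].
    by rewrite mem_meet => /andP[sK sJ]; rewrite main ?udK.
  have [sJ | nsJ] := boolP (s ^ d^-1 \in P J).
    by rewrite -main // udK // mem_meet sK.
  rewrite invM (X_inv dK) ?mem_gen //=.
  by apply: contraNF nsJ; apply: (inv_gen (valP J)).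
(* [rep w'] is the X_J-component of w'; by [coset_min] the default 1 never occurs. Below, [f] sends
   d back to b = x^-1 w, with x the X_J-component of w d^-1. *)
pose rep w' : W := odflt 1 [pick x in X_ J | x^-1 * w' \in P J].
have repP w' : rep w' \in X_ J /\ (rep w')^-1 * w' \in P J.
  rewrite /rep; case: pickP => [x /andP[] // | none].
  have [x [u [xJ uJ wE _]]] := coset_min J w'.
  by have := none x; rewrite xJ wE mulKg uJ.
pose f d := (rep (w * d^-1))^-1 * w.
have fE d : f d = (rep (w * d^-1))^-1 * (w * d^-1) * d.
  by rewrite /f -!mulgA mulVg mulg1.
have wE d : w = rep (w * d^-1) * ((rep (w * d^-1))^-1 * (w * d^-1)) * d.
  by rewrite mulKVg mulgKV.
have f_inj : {in double_reps J K &, injective f}.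
  move=> d d' /setIdP[_ dJ] /setIdP[_ dJ'] eq_f.
  suff /(X_uniq dJ dJ')/invg_inj : d^-1^-1 * d'^-1 \in P J by [].
  rewrite invgK.
  have [_ uJ] := repP (w * d^-1); have [_ uJ'] := repP (w * d'^-1).
  move: eq_f; rewrite !fE; set u := _ * (w * d^-1); set u' := _ * (w * d'^-1).
  move=> eq_f; have -> : d * d'^-1 = u^-1 * u'.
    by apply: (mulgI u); rewrite mulgA eq_f mulgK mulKVg.
  by rewrite groupM ?groupV.
rewrite -[RHS](card_in_imset (f := f)); last first.
  by move=> d d' /setIdP[dD _] /setIdP[dD' _]; apply: f_inj.
apply/eq_card => b; apply/setIdP/imsetP => [[bK wbJ] | [d /setIdP[dD wX] ->]].
  have [u [d [uJ dJ bE]]] := left_split J b.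
  have dD : d \in double_reps J K by apply: (double_repP uJ); rewrite -?bE.
  have [rJ ruJ] := repP (w * d^-1).
  have xE : w * b^-1 = rep (w * d^-1).
    apply: (X_uniq wbJ rJ).
    rewrite bE -(invgK (rep _)) -invMg groupV.
    have -> : (rep (w * d^-1))^-1 * (w * (u * d)^-1)
            = (rep (w * d^-1))^-1 * (w * d^-1) * u^-1 by rewrite invMg !mulgA.
    by rewrite groupM ?groupV.
  have fd : f d = b by rewrite /f -xE invMg invgK mulgKV.
  exists d => //; apply/setIdP; split=> //.
  by have := key _ _ _ rJ ruJ dD; rewrite -fE -wE fd bK => <-.
have [rJ ruJ] := repP (w * d^-1).
split; first by rewrite fE (key _ _ _ rJ ruJ dD) -wE.
by rewrite /f invMg invgK mulKVg.
Qed.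

(** The minimal representative of y v W_L stays in W_I v: a letter s applied to z either stays in
    X_L or, by [deodhar], fixes the coset z W_L. *)
Lemma coset_orbit I L y v : y \in P I -> v \in X_ L ->
  exists z, [/\ z \in X_ L, z * v^-1 \in P I & z^-1 * (y * v) \in P L].
Proof.
case/gen_wordP => p pI -> vL; elim: p pI => [|s p IHp] pI.
  by exists v; rewrite big_nil mul1g mulgV mulVg !group1.
have [|z [zL zI zu]] := IHp; first by move=> r rp; rewrite pI // inE rp orbT.
have sI : s \in val I by rewrite pI ?mem_head.
have sS := subsetP (valP I) s sI.
rewrite big_cons; have [szL | nszL] := boolP (s * z \in X_ L).
  exists (s * z); split=> //; first by rewrite -mulgA groupM // mem_gen.
  by rewrite invMg -!mulgA mulKg.
exists z; split=> //.
have -> : z^-1 * (s * \prod_(j <- p) j * v) =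
  s ^ z * (z^-1 * (\prod_(j <- p) j * v)).
  by rewrite conjgE -!mulgA mulKVg.
by rewrite groupM // mem_gen // (deodhar sS zL).
Qed.

Lemma simple_gen_mem I s : s \in S -> s \in P I -> s \in val I.
Proof.
move=> sS sI.
have [t tI] := inv_descent hS (valP I) sI (simple_neq1 sS).
by rewrite inv_simple // => /eqP <-.
Qed.

(* Otherwise s u is again minimal in its coset modulo W_L, and coset_orbit
   applied to b gives u = z s u with z in W_I, so that s lies in W_I. *)
Lemma fix_last_letter I L b s u : s \in S -> s \notin val I -> b \in P I ->
  (b * s) ^ u \in P L -> s ^ u \in P L.
Proof.
move=> sS sI bI.
have [x [v [xL vL -> _]]] := coset_min L u.
rewrite !conjgM !(groupJr _ vL) => bsx.
have [sxL | /(deodhar sS xL)/mem_gen //] := boolP (s * x \in X_ L).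
have [z [zL zI zu]] := coset_orbit bI sxL.
have zx : x = z.
  apply: (X_uniq xL zL); rewrite -groupV invMg invgK.
  have -> : z^-1 * x = z^-1 * (b * (s * x)) * ((b * s) ^ x)^-1.
    by rewrite conjgE !invMg invgK !mulgA !mulgK.
  by rewrite groupM ?groupV.
case/negP: sI; apply: simple_gen_mem => //.
by have := zI; rewrite -zx invMg mulKVg groupV.
Qed.

(** The letters of a Coxeter element are distinct, so the last one is outside the set I of the
    preceding ones; [fix_last_letter] then peels off the letters from the right. *)
Lemma coxeter_fix K w u L : coxeter_element K w -> w ^ u \in P L ->
  val K :^ u \subset P L.
Proof.
case=> p pK ->; have p_uniq : uniq p by rewrite (perm_uniq pK) enum_uniq.
have pS : {subset p <= S}.
  by move=> s; rewrite (perm_mem pK) mem_enum => /(subsetP (valP K)).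
suff main : (\prod_(x <- p) x) ^ u \in P L -> {in p, forall s, s ^ u \in P L}.
  move=> /main pL; apply/subsetP => _ /imsetP[s sK ->].
  by rewrite pL // (perm_mem pK) mem_enum.
elim/last_ind: p {pK} p_uniq pS => [|p s IHp] //=.
rewrite rcons_uniq => /andP[sp p_uniq] pS.
have pS' : {subset p <= S} by move=> t tp; rewrite pS // mem_rcons inE tp orbT.
have sS : s \in S by rewrite pS // mem_rcons mem_head.
have IS : [set t in p] \subset S by apply/subsetP => t; rewrite inE; apply: pS'.
pose I : subS S := exist (fun A : {set W} => A \subset S) _ IS.
rewrite -cats1 big_cat big_seq1 => psL.
have sL : s ^ u \in P L.
  apply: (@fix_last_letter I L (\prod_(x <- p) x)) => //; first by rewrite inE.
  by apply/gen_wordP; exists p => // t; rewrite inE.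
move=> t; rewrite mem_cat inE => /orP[tp | /eqP-> //].
by apply: IHp => //; move: psL; rewrite conjMg groupMr.
Qed.

(** Passing from v to the minimal element of W_J v W_K changes the intersection only by a
    conjugation in W_K, and [meet_gen] applies. *)
Lemma parabolicI J K v : exists L z, P K :&: P J :^ v = P L :^ z.
Proof.
have [x [z [xK zK -> _]]] := coset_min K v.
have [u [d [uJ dJ xE]]] := left_split J x.
have dD : d \in double_reps J K by apply: (double_repP uJ); rewrite -?xE.
exists (meet J K d), z; rewrite -(meet_gen dD) xE conjIg !conjsgM.
by rewrite (conjGid uJ) (conjGid zK).
Qed.

(* The smallest parabolic subgroup containing A. *)
Lemma parabolic_closure (A : {set W}) : exists K y, A \subset P K :^ y /\
  forall J u, A :^ u \subset P J -> (P K :^ y) :^ u \subset P J.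
Proof.
pose Q (Ky : subS S * W) := A \subset P Ky.1 :^ Ky.2.
have QS : Q (exist (fun A : {set W} => A \subset S) S (subxx S), 1).
  by apply/subsetP => w _; rewrite mem_conjg simple_gen.
case: (arg_minnP (fun Ky : subS S * W => #|P Ky.1|) QS) => -[K y] QK min_K.
have {}QK : A \subset P K :^ y := QK.
exists K, y; split=> // J u AJ.
(* The intersection of the two parabolic subgroups containing A is again parabolic, so the minimal
   order of W_K forces it to be the first of them. *)
have [L [z eqI]] := parabolicI J K (u^-1 * y^-1).
have AL : A \subset P L :^ (z * y).
  rewrite conjsgM -eqI conjIg subsetI QK /= !conjsgM conjsgKV.
  by rewrite -sub_conjg.
have := min_K (L, z * y) AL => /= le_KL.
have eqK : P K :&: P J :^ (u^-1 * y^-1) = P K.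
  by apply/eqP; rewrite eqEcard subsetIl eqI cardJg.
by rewrite sub_conjg sub_conjg -conjsgM -eqK subsetIr.
Qed.

End Parabolic.

(** * Fixed cosets *)

Section Marks.

Variables (W : finGroupType) (S : {set W}).
Hypothesis hS : coxeter_system S.
Implicit Types (s t u v w x y d b : W) (I J K L : subS S) (A : {set W}).

Local Notation P J := <<val J>>.

(* The number of cosets uW_J fixed by A, for any subset A of W. *)
Definition mark J A : nat := #|[set u in X_ J | A :^ u \subset P J]|.

Lemma perm_charE J w : perm_char J w = mark J [set w].
Proof.
rewrite /perm_char /mark -(card_in_imset (f := fun u => u *: P J)); last first.
  move=> u v /setIdP[uJ _] /setIdP[vJ _] /lcoset_eqP.
  by rewrite lcoset_sym mem_lcoset; apply: (X_uniq hS).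
apply/eq_card => C; apply/setIdP/imsetP => [[] | [u /setIdP[uJ wu] ->]].
  case/lcosetsP=> v _ ->; have [x [u [xJ uJ -> _]]] := coset_min hS J v.
  rewrite lcosetM lcoset_id // -lcosetM => /eqP/lcoset_eqP.
  rewrite mem_lcoset -conjgE => wx; exists x => //.
  by rewrite inE xJ conjg_set1 sub1set.
split; first by apply/lcosetsP; exists u; rewrite ?inE.
move: wu; rewrite conjg_set1 sub1set conjgE => wu.
by rewrite -lcosetM; apply/eqP/lcoset_eqP; rewrite mem_lcoset.
Qed.

Lemma mark_gen J A : mark J <<A>> = mark J A.
Proof. by rewrite /mark; apply: eq_card => u; rewrite !inE -genJ gen_subG. Qed.

(** Inversion turns left cosets into right cosets, where the action ['Rs] and its fixed-point
    congruence are available. *)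
Lemma mark_fix J A : mark J A = #|'Fix_(rcosets (P J) [set: W] | 'Rs)(A)|.
Proof.
rewrite /mark -(card_in_imset (f := fun u => P J :* u^-1)); last first.
  move=> u v /setIdP[uJ _] /setIdP[vJ _] /rcoset_eqP.
  by rewrite mem_rcoset invgK; apply: (X_uniq hS).
apply/eq_card => C; apply/imsetP/setIP => [[u /setIdP[uJ Au] ->] | []].
  rewrite sub_afixRs_norms -sub_conjg Au.
  by split=> //; apply/rcosetsP; exists u^-1; rewrite ?inE.
case/rcosetsP=> v _ ->; have [x [u [xJ uJ vE _]]] := coset_min hS J v^-1.
have -> : v = u^-1 * x^-1 by rewrite -invMg -vE invgK.
rewrite rcosetM rcoset_id ?groupV // sub_afixRs_norms -sub_conjg => Ax.
by exists x => //; rewrite inE xJ.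
Qed.

Lemma mark_conj J A y : mark J (A :^ y) = mark J A.
Proof.
rewrite !mark_fix -[RHS](card_imset _ (can_inj (rcosetK y))).
apply/eq_card => C; apply/setIP/imsetP.
  case=> /rcosetsP[x _ ->]; rewrite sub_afixRs_norms -sub_conjgV -conjsgM => Ax.
  exists (P J :* (x * y^-1)); last by rewrite -rcosetM mulgKV.
  rewrite inE sub_afixRs_norms -sub_conjgV invMg invgK Ax andbT.
  by apply/rcosetsP; exists (x * y^-1); rewrite ?inE.
case=> C' /setIP[/rcosetsP[x _ ->]];
  rewrite sub_afixRs_norms -sub_conjgV => Ax ->.
rewrite -rcosetM sub_afixRs_norms -sub_conjgV invMg -conjsgM mulKVg Ax.
by split=> //; apply/rcosetsP; exists (x * y); rewrite ?inE.
Qed.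

Lemma mark_conj_eq J K L : conj_eq K L -> mark J (val K) = mark J (val L).
Proof. by case/existsP=> w /eqP <-; rewrite mark_conj. Qed.

(** By [coxeter_fix], a Coxeter element fixes exactly the cosets fixed by all of W_K, so the value
    does not depend on its choice. *)
Lemma mark_coxeter J K w : coxeter_element K w ->
  perm_char J w = mark J (val K).
Proof.
move=> cw; rewrite perm_charE; apply: eq_card => u; rewrite !inE;
  congr (_ && _).
rewrite conjg_set1 sub1set; apply/idP/idP => [/(coxeter_fix hS cw) // | Ku].
have wK : w \in P K.
  case: cw => p pK ->; apply/gen_wordP; exists p => // s.
  by rewrite (perm_mem pK) mem_enum.
have PKu : P K :^ u \subset P J by rewrite -genJ gen_subG.
by rewrite (subsetP PKu) // memJ_conjg.
Qed.

(** Put d = u^-1. For t in K, t ^ u lies in W_J and is no inversion of u, so t is no inversion of d;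
    hence d is in X_K. *)
Lemma mark_reps J K :
  mark J (val K) = #|[set d in double_reps J K | meet J K d == K]|.
Proof.
rewrite /mark -(card_imset _ invg_inj).
apply/eq_card => d; apply/imsetP/setIdP =>
  [[u /setIdP[uJ Ku] ->] | [dD /eqP eqK]].
  have meetE t : t \in val K -> t ^ u \in P J.
    by move=> tK; rewrite (subsetP Ku) // memJ_conjg.
  split; last first.
    rewrite -val_eqE /=; apply/eqP/setIidPl/subsetP => t tK.
    by rewrite mem_conjg invgK meetE.
  rewrite inE invgK uJ andbT; apply/(X_P hS) => t tK.
  by rewrite invV (X_inv hS uJ) // meetE.
move: dD; rewrite inE => /andP[_ dJ]; exists d^-1; last by rewrite invgK.
rewrite inE dJ sub_conjg invgK /=; rewrite -{1}eqK; exact: subsetIr.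
Qed.

Lemma mark_gt0 J K : (0 < mark J (val K))%N -> conj_subset K J.
Proof.
rewrite mark_reps card_gt0 => /set0Pn[d /setIdP[dD /eqP eqK]].
by apply/existsP; exists d; rewrite -{1}eqK; apply: meet_conj.
Qed.

Lemma mark_self K : (0 < mark K (val K))%N.
Proof.
rewrite card_gt0; apply/set0Pn; exists 1; rewrite inE conjsg1 subset_gen andbT.
by apply/(X_P hS) => s _; rewrite inv1.
Qed.

Lemma mark_closure A : exists K y, A \subset P K :^ y /\
  forall J, mark J A = mark J (val K).
Proof.
have [K [y [AK minK]]] := parabolic_closure hS A.
exists K, y; split=> // J; rewrite -(mark_conj J (val K) y) /mark.
apply: eq_card => u; rewrite !inE; congr (_ && _);
  apply/idP/idP => [/minK | Ku].
  by apply: subset_trans; rewrite -!genJ subset_gen.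
by apply: subset_trans (_ : (P K :^ y) :^ u \subset _);
  rewrite ?conjSg // -!genJ gen_subG.
Qed.

(* A Sylow q-subgroup Q of N(W_K) acts on the cosets fixed by W_K; its fixed
   points are the cosets fixed by the parabolic closure of W_K and Q. *)
Lemma mark_modp q K : prime q -> (q %| mark K (val K))%N ->
  exists2 L : subS S, (#|P K| < #|P L|)%N
    & forall J, mark J (val K) = mark J (val L) %[mod q].
Proof.
move=> q_pr; rewrite -mark_gen mark_fix afixRs_rcosets => q_dv.
have [Q sylQ] := Sylow_exists q ('N(P K)).
have QN : Q \subset 'N(P K) := pHall_sub sylQ.
have [L [y [AL markL]]] := mark_closure (P K :|: Q).
have [KL QL] : P K \subset P L :^ y /\ Q \subset P L :^ y.
  by apply/andP; rewrite -subUset.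
exists L => [|J].
  rewrite -(cardJg (P L) y) ltn_neqAle subset_leq_card // andbT.
  (* If the orders agreed, the Sylow subgroup Q would lie in W_K, and q could not divide
     [N(W_K) : W_K]. *)
  apply: contraL q_dv => /eqP eqKL.
  have eqK : P K = P L :^ y by apply/eqP; rewrite eqEcard KL eqKL leqnn.
  have QK : Q \subset P K by rewrite eqK.
  have /and3P[_ _] := sylQ; rewrite p'natE //; apply: contra => /dvdn_trans;
    apply.
  by rewrite setTI indexgS.
rewrite -markL -mark_gen !mark_fix.
have actQ : [acts Q, on 'Fix_(rcosets (P J) [set: W] | 'Rs)(P K) | 'Rs].
  apply: actsI; last exact: acts_fix_norm.
  exact: subset_trans (subsetT Q) (actsRs_rcosets _ [set: W]%G).
rewrite (pgroup_fix_mod (pHall_pgroup sylQ) actQ) -setIA -afixU.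
by [].
Qed.

End Marks.

(* The hypothesis is a parameter of the type so that the ring structure, whose
   laws depend on it, can be canonical. *)
Definition dalg (W : finGroupType) (S : {set W}) of coxeter_system S :=
  fun k : fieldType => descent S k.

(** * Solomon's formula and the ring structure *)

Section Solomon.

Variables (W : finGroupType) (S : {set W}).
Hypothesis hS : coxeter_system S.
Implicit Types (s t u v w x y d : W) (I J K L : subS S) (A : {set W}).

Local Notation P J := <<val J>>.

(** The longest element of the parabolic subgroup of S \ J works: by maximality each element of S \
    J is a descent, and by [inv_gen] there are no others. *)
Lemma ascent_set J : exists w, forall K, (w \in X_ K) = (val K \subset val J).
Proof.
pose T : subS S := exist (fun A : {set W} => A \subset S)
  (S :\: val J) (subsetDl _ _).
have T1 : 1 \in P T := group1 _.
case: (arg_maxnP (fun w => len S w) T1) => w wT max_w.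
exists w => K; have wE s : s \in S -> inv hS w s = (s \notin val J).
  move=> sS; apply/idP/idP => [ws | sJ].
    have := inv_gen (valP T) wT ws => /(simple_gen_mem hS sS).
    by rewrite inE => /andP[].
  apply/negPn; rewrite -(len_simple hS w sS) -leqNgt.
  suff /max_w : w * s \in P T by [].
  by rewrite groupM // mem_gen // inE sJ.
apply/(X_P hS)/subsetP => sub s sK; have sS := subsetP (valP K) s sK.
  by apply/negPn; rewrite -wE // sub.
by rewrite wE // sub.
Qed.

(** Evaluating at the element of [ascent_set J] leaves only the subsets of J, so induction on
    cardinality applies. The general V serves both int and k. *)
Lemma X_independent (V : zmodType) (c : subS S -> V) :
  (forall w, (\sum_(J | w \in X_ J) c J)%R = 0%R) -> forall J, c J = 0%R.
Proof.
move=> c0 J; have [n] := ubnP #|val J|; elim: n J => // n IHn J.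
rewrite ltnS => leJn; have [w wE] := ascent_set J.
have := c0 w; rewrite (bigD1 J) ?wE //= big1 ?addr0 // => K /andP[].
rewrite wE => KJ neKJ; apply: IHn; apply: leq_trans leJn; apply: proper_card.
by rewrite properEneq KJ andbT.
Qed.

(* The coefficient of x_L in x_J x_K. *)
Definition struct_const J K L : nat :=
  #|[set d in double_reps J K | meet J K d == L]|.

Lemma mark_struct J K : mark J (val K) = struct_const J K K.
Proof. exact: mark_reps. Qed.

Lemma struct_const_gt0 J K L : (0 < struct_const J K L)%N ->
  val L \subset val K /\ conj_subset L J.
Proof.
rewrite card_gt0 => /set0Pn[d /setIdP[dD /eqP <-]]; split;
  first exact: meet_sub.
by apply/existsP; exists d; apply: (meet_conj hS).
Qed.

(** Solomon's formula read off at w: substitute b = u^-1 w, apply [double_reps_count], and group the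
    d by [meet J K d]. *)
Lemma struct_count J K w :
  #|[set u in X_ J | u^-1 * w \in X_ K]| =
    (\sum_(L | w \in X_ L) struct_const J K L)%N.
Proof.
pose f u := u^-1 * w; have f_inj : injective f by move=> u v /mulIg/invg_inj.
rewrite -(card_imset _ f_inj).
have -> : f @: [set u in X_ J | u^-1 * w \in X_ K] =
  [set b in X_ K | w * b^-1 \in X_ J].
  apply/setP => b; apply/imsetP/setIdP => [[u /setIdP[uJ uK] ->]|[bK bJ]].
    by rewrite uK /f invMg invgK mulKVg.
  by exists (w * b^-1); rewrite /f ?invMg ?invgK ?mulgKV // inE bJ invMg invgK
    mulgKV.
rewrite double_reps_count // -sum1_card.
rewrite (partition_big (meet J K) (fun L => w \in X_ L)) /=.
  apply: eq_bigr => L wL; rewrite /struct_const -sum1_card; apply: eq_bigl => d.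
  apply/andP/setIdP => [[/setIdP[] //] | [dD eqL]].
  by split=> //; apply/setIdP; rewrite (eqP eqL).
by move=> d /setIdP[].
Qed.

Local Open Scope ring_scope.


Lemma zw_ofE u w : zw_of u w = (w == u)%:R.
Proof. by rewrite ffunE. Qed.

Lemma zxE J w : zx J w = (w \in X_ J)%:R.
Proof.
rewrite /zx sum_ffunE; under eq_bigr do rewrite zw_ofE.
have [wJ | wJ] := boolP (w \in X_ J).
  by rewrite (bigD1 w) //= eqxx big1 ?addr0 // => u /andP[_ /negbTE];
    rewrite eq_sym => ->.
by rewrite big1 // => u uJ; case: eqP => // eq_wu; rewrite eq_wu uJ in wJ.
Qed.

Lemma sum_zxE (c : subS S -> int) w :
  (\sum_J zx J *~ c J) w = \sum_(J | w \in X_ J) c J.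
Proof.
rewrite sum_ffunE big_mkcond [RHS]big_mkcond /=; apply: eq_bigr => J _.
have -> : (zx J *~ c J) w = zx J w *~ c J.
  by case: (c J) => n; rewrite ?NegzE ?mulrNz -!pmulrn ?ffunE ffunMnE.
by rewrite zxE; case: (w \in X_ J); rewrite ?mul0rz // intz.
Qed.

Lemma zcoord_sum (c : {ffun subS S -> int}) : zcoord S (\sum_J zx J *~ c J) = c.
Proof.
apply: classical_sets.xget_unique => // c' eq_c; apply/ffunP => J.
apply/eqP; rewrite -subr_eq0; apply/eqP; move: J.
apply: (@X_independent _ (fun J => c' J - c J)) => w.
by rewrite sumrB -!sum_zxE eq_c subrr.
Qed.

Lemma zx_mul J K : zw_mul (zx J) (zx K) =
  \sum_L zx L *~ (struct_const J K L)%:Z.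
Proof.
apply/ffunP => w; rewrite sum_zxE ffunE.
have -> : \sum_(L | w \in X_ L) (struct_const J K L)%:Z
          = (\sum_(L | w \in X_ L) struct_const J K L)%N%:Z.
  by rewrite -natz raddf_sum /=; apply: eq_bigr => L _; rewrite natz.
rewrite -struct_count -sum1dep_card -natz natr_sum [RHS]big_mkcond /=.
apply: eq_bigr => u _; rewrite !zxE.
by do 2!case: (_ \in _); rewrite ?mulr1 ?mulr0.
Qed.

Lemma zcoord_zx_mul J K L : zcoord S (zw_mul (zx J) (zx K)) L =
  struct_const J K L :> int.
Proof.
rewrite zx_mul.
have -> : \sum_M zx M *~ (struct_const J K M)%:Z
     = \sum_M zx M *~ [ffun M => (struct_const J K M)%:Z] M.
  by apply: eq_bigr => M _; rewrite ffunE.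
by rewrite zcoord_sum ffunE.
Qed.

Definition fullS : subS S := exist (fun A : {set W} => A \subset S) S (subxx S).

Lemma X_full w : (w \in X_ fullS) = (w == 1%g).
Proof.
apply/(X_P hS)/eqP => [wS | -> s _]; last exact: inv1.
apply/eqP/negPn/negP => w1.
have [s sS ws] := inv_descent hS (subxx S) (simple_gen hS w) w1.
by rewrite (wS s sS) in ws.
Qed.

(** * The product of the descent algebra over k *)

Section OverField.

Variable k : fieldType.
Implicit Types a b c : descent S k.

Lemma dmulE a b L :
  dmul a b L = \sum_J \sum_K a J * b K * (struct_const J K L)%:R.
Proof.
rewrite /dmul sum_ffunE; apply: eq_bigr => J _; rewrite sum_ffunE.
by apply: eq_bigr => K _; rewrite !ffunE zcoord_zx_mul.
Qed.

Lemma d1E : d1 S k = dx k fullS.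
Proof.
apply/ffunP => J; rewrite !ffunE.
have -> : zw_of 1%g = \sum_J zx J *~ [ffun J => (J == fullS)%:Z] J :> ZW W.
  apply/ffunP => w; rewrite zw_ofE sum_zxE -X_full big_mkcond (bigD1 fullS) //=.
  rewrite big1 ?addr0 => [|K /negbTE neK]; rewrite ffunE ?neK ?if_same //.
  by rewrite eqxx; case: ifP.
by rewrite zcoord_sum ffunE; case: eqP.
Qed.

(* The embedding of D_k into the group algebra kW. *)
Definition embed a : {ffun W -> k} := [ffun w => \sum_(J | w \in X_ J) a J].

Lemma embed_inj a b : embed a = embed b -> a = b.
Proof.
move=> /ffunP eq_ab; apply/ffunP => J; apply/eqP; rewrite -subr_eq0; apply/eqP;
  move: J.
apply: (@X_independent _ (fun J => a J - b J)) => w.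
by have := eq_ab w; rewrite sumrB !ffunE => ->; rewrite subrr.
Qed.

Lemma embed_mul a b w :
  embed (dmul a b) w = \sum_u embed a u * embed b (u^-1 * w)%g.
Proof.
rewrite ffunE; under eq_bigr do rewrite dmulE.
rewrite exchange_big; under eq_bigr do rewrite exchange_big.
have sum_embed c v : embed c v = \sum_J c J * (v \in X_ J)%:R.
  rewrite ffunE big_mkcond; apply: eq_bigr => J _.
  by case: (v \in X_ J); rewrite ?mulr1 ?mulr0.
under [RHS]eq_bigr do rewrite !sum_embed mulr_suml.
rewrite [RHS]exchange_big; apply: eq_bigr => J _.
under [RHS]eq_bigr do rewrite mulr_sumr.
rewrite [RHS]exchange_big; apply: eq_bigr => K _.
rewrite -mulr_sumr -natr_sum -struct_count -sum1dep_card natr_sum.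
rewrite [X in _ * X]big_mkcond.
rewrite mulr_sumr; apply: eq_bigr => u _.
by do 2!case: (_ \in _); rewrite ?(mulr1, mulr0, mul0r).
Qed.

Lemma embed1 w : embed (d1 S k) w = (w == 1%g)%:R.
Proof.
rewrite ffunE d1E -X_full big_mkcond (bigD1 fullS) //= ffunE eqxx big1 ?addr0.
  by case: ifP.
by move=> K /negbTE neK; rewrite ffunE neK if_same.
Qed.

(** [embed] turns the product into convolution on W, where associativity is a change of
    variables. *)
Lemma dmulA : associative (@dmul W S k).
Proof.
move=> a b c; apply: embed_inj; apply/ffunP => w; rewrite !embed_mul.
under eq_bigr do rewrite embed_mul mulr_sumr.
under [RHS]eq_bigr do rewrite embed_mul mulr_suml.
rewrite [RHS]exchange_big; apply: eq_bigr => u _.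
rewrite [RHS](reindex_inj (mulgI u)); apply: eq_bigr => v _.
by rewrite invMg mulKg !mulgA mulrA.
Qed.

Lemma dmul1l : left_id (d1 S k) (@dmul W S k).
Proof.
move=> a; apply: embed_inj; apply/ffunP => w.
rewrite embed_mul (bigD1 1%g) //= embed1 eqxx mul1r invg1 mul1g big1 ?addr0 //.
by move=> u /negbTE u1; rewrite embed1 u1 mul0r.
Qed.

Lemma dmul1r : right_id (d1 S k) (@dmul W S k).
Proof.
move=> a; apply: embed_inj; apply/ffunP => w.
rewrite embed_mul (bigD1 w) //= embed1 mulVg eqxx mulr1 big1 ?addr0 //.
move=> u; rewrite embed1 -eq_mulVg1 => /negbTE uw; by rewrite uw mulr0.
Qed.

Lemma dmulDl : left_distributive (@dmul W S k) +%R.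
Proof.
move=> a b c; apply/ffunP => L; rewrite ffunE !dmulE -big_split;
  apply: eq_bigr => J _.
by rewrite -big_split; apply: eq_bigr => K _; rewrite ffunE !mulrDl.
Qed.

Lemma dmulDr : right_distributive (@dmul W S k) +%R.
Proof.
move=> a b c; apply/ffunP => L; rewrite ffunE !dmulE -big_split;
  apply: eq_bigr => J _.
by rewrite -big_split; apply: eq_bigr => K _; rewrite ffunE mulrDr mulrDl.
Qed.

Lemma d1_neq0 : d1 S k != 0.
Proof.
apply/eqP => /ffunP/(_ fullS); rewrite d1E !ffunE eqxx => /eqP.
by rewrite oner_eq0.
Qed.

HB.instance Definition _ := GRing.Lmodule.copy (dalg hS k) (descent S k).
HB.instance Definition _ := GRing.Zmodule_isPzRing.Build (dalg hS k)
  dmulA dmul1l dmul1r dmulDl dmulDr.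
HB.instance Definition _ :=
  GRing.PzSemiRing_isNonZero.Build (dalg hS k) d1_neq0.

End OverField.

End Solomon.

Local Open Scope ring_scope.

(** * Lifting idempotents *)

Section IdempotentLifting.

Variable A : nzRingType.
Implicit Types a g x : A.

Definition lift_step a : A := a * a *+ 3 - a * a * a *+ 2.

Lemma lift_step_idem a : a * a = a -> lift_step a = a.
Proof. by rewrite /lift_step => aa; rewrite !aa -mulrnBr. Qed.

(** An identity in Z[X], evaluated at a: with D = X^2 - X and P = 3 X^2 - 2 X^3 one has P^2 - P =
    D^2 (4 D - 3), so each step halves the nilpotency exponent. *)
Lemma lift_step_nilpotent a n :
  (a * a - a) ^+ n.*2 = 0 -> (lift_step a * lift_step a - lift_step a) ^+ n = 0.
Proof.
have comm_a : commr_rmorph (intmul (1 : A)) a by move=> z; apply: commr_int.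
pose f : {rmorphism {poly int} -> A} := horner_morph comm_a.
have fX : f 'X = a by apply: horner_morphX.
pose P : {poly int} := 'X * 'X *+ 3 - 'X * 'X * 'X *+ 2.
pose D : {poly int} := 'X * 'X - 'X.
have -> : a * a - a = f D by rewrite /D rmorphB rmorphM /= fX.
have -> : lift_step a = f P by rewrite /P rmorphB !rmorphMn !rmorphM /= fX.
have PD : P * P - P = D * D * (D *+ 4 - 3%:R).
  by rewrite /P /D; ring.
rewrite -!rmorphM -rmorphB PD -!rmorphXn exprMn rmorphM /= => D0.
by rewrite -expr2 -exprM mul2n D0 mul0r.
Qed.

(** Since 2^m >= m, the exponent may be taken to be 2^m; after m halvings it is 1, and an idempotent
    is a fixed point. *)
Lemma lift_step_converges a m : (a * a - a) ^+ m = 0 ->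
  exists2 N, forall r, (N <= r)%N -> iter r lift_step a = iter N lift_step a
           & iter N lift_step a * iter N lift_step a = iter N lift_step a.
Proof.
move=> am; have {am} a2m : (a * a - a) ^+ (2 ^ m) = 0.
  by rewrite -(subnK (ltnW (ltn_expl m (isT : 1 < 2)%N))) exprD am mulr0.
suff idem : iter m lift_step a * iter m lift_step a = iter m lift_step a.
  exists m => // r /subnK <-; elim: (r - m)%N => // j IHj.
  by rewrite addSn iterS IHj lift_step_idem.
elim: m a a2m => [|m IHm] a; first by rewrite expr1 => /eqP;
  rewrite subr_eq0 => /eqP.
by rewrite expnS mul2n => /lift_step_nilpotent/IHm; rewrite -iterSr.
Qed.

Lemma lift_step_corner g x : g * x = x -> x * g = x ->
  g * lift_step x = lift_step x /\ lift_step x * g = lift_step x.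
Proof.
move=> gx xg; rewrite /lift_step; split.
  by rewrite mulrBr !mulrnAr !mulrA gx.
by rewrite mulrBl !mulrnAl -!mulrA xg.
Qed.

Lemma iter_lift_corner g x r : g * x = x -> x * g = x ->
  g * iter r lift_step x = iter r lift_step x /\
  iter r lift_step x * g = iter r lift_step x.
Proof. by move=> gx xg; elim: r => //= r [IH1 IH2];
  apply: lift_step_corner. Qed.

End IdempotentLifting.

(** * Characters and ideals of the descent algebra *)

Section DescentAlgebra.

Variables (W : finGroupType) (S : {set W}).
Hypothesis hS : coxeter_system S.
Variable k : fieldType.
Implicit Types (J K L M : subS S) (a b : dalg hS k) (Q : pred (subS S)).

(** The polynomial p = 3 X^2 - 2 X^3 satisfies p(1 - X) = 1 - p(X); here g is the unit of its corner
    ring. *)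
Lemma lift_step_compl (g h : dalg hS k) : g * g = g -> g * h = h -> h * g = h ->
  lift_step (g - h) = g - lift_step h.
Proof.
move=> gg gh hg; have ghh : g * (h * h) = h * h by rewrite mulrA gh.
rewrite /lift_step !(mulrBr, mulrBl) -?mulrA !(gg, gh, hg, ghh).
by apply/ffunP => K; rewrite !ffunE /=; ring.
Qed.

Lemma iter_lift_compl (g h : dalg hS k) r : g * g = g -> g * h = h ->
  h * g = h ->
  iter r (@lift_step _) (g - h) = g - iter r (@lift_step _) h.
Proof.
move=> gg gh hg; elim: r => //= r ->.
by have [gr rg] := iter_lift_corner r gh hg; rewrite lift_step_compl.
Qed.

Lemma mul_coordE a b L :
  (a * b) L = \sum_J \sum_K a J * b K * (struct_const J K L)%:R.
Proof. exact: dmulE. Qed.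

(* theta(a)(c_K), which is also the diagonal entry at x_K of the left
   multiplication by a. *)
Definition tau K a : k := \sum_J a J * (mark J (val K))%:R.

(** Only those L containing K contribute to the coefficient at K, and the assumption on b leaves L =
    K: this is the triangularity of left multiplication. *)
Lemma tau_coord a b K : (forall L, val K \proper val L -> b L = 0) ->
  (a * b) K = tau K a * b K.
Proof.
move=> bK; rewrite mul_coordE /tau mulr_suml; apply: eq_bigr => J _.
rewrite (bigD1 K) //= big1 ?addr0 => [|L neLK].
  by rewrite mark_struct // mulrAC.
have [->|/(struct_const_gt0 hS)[sub _]] := posnP (struct_const J L K).
  by rewrite mulr0.
by rewrite bK ?mulr0 ?mul0r // properEneq sub andbT val_eqE eq_sym.
Qed.


Lemma dx_E K L : (dx k K) L = (L == K)%:R. Proof. by rewrite ffunE. Qed.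

Lemma tau_dx K J : tau K (dx k J : dalg hS k) = (mark J (val K))%:R.
Proof.
rewrite /tau (bigD1 J) //= dx_E eqxx mul1r big1 ?addr0 // => L /negbTE neLJ.
by rewrite dx_E neLJ mul0r.
Qed.

Lemma tau_coord_dx a K : tau K a = (a * (dx k K : dalg hS k)) K.
Proof.
rewrite tau_coord ?dx_E ?eqxx ?mulr1 // => L /properP[_ [x xL xK]].
by rewrite dx_E; case: eqP => // eqL; rewrite eqL (negbTE xK) in xL.
Qed.

Lemma mul_dx_supp a K L : (a * (dx k K : dalg hS k)) L != 0 ->
  val L \subset val K.
Proof.
apply: contraR => LK; rewrite mul_coordE big1 // => J _; rewrite big1 // => M _.
rewrite dx_E; case: eqP => [->|]; last by rewrite mulr0 mul0r.
have [->|/(struct_const_gt0 hS)[]] := posnP (struct_const J K L);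
  first by rewrite mulr0.
by rewrite (negbTE LK).
Qed.

Lemma tauM K a b : tau K (a * b) = tau K a * tau K b.
Proof.
rewrite (tau_coord_dx (a * b)) -mulrA tau_coord -?tau_coord_dx // => L KL.
apply/eqP/negPn/negP => /mul_dx_supp LK.
by have := proper_sub_trans KL LK; rewrite properxx.
Qed.

Lemma tauB K a b : tau K (a - b) = tau K a - tau K b.
Proof.
by rewrite /tau -sumrB; apply: eq_bigr => J _; rewrite !ffunE mulrBl.
Qed.

Lemma tau1 K : tau K (1 : dalg hS k) = 1.
Proof. by rewrite tau_coord_dx mul1r dx_E eqxx. Qed.

HB.instance Definition _ K := GRing.isZmodMorphism.Build _ _ (tau K) (tauB K).
HB.instance Definition _ K :=
  GRing.isMonoidMorphism.Build _ _ (tau K) (tau1 K, tauM K).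

(** Each multiplication by a strictly triangular element lowers by one the largest cardinality that
    can occur in the support. *)
Lemma tau_nilpotent a : (forall K, tau K a = 0) -> a ^+ #|S|.+1 = 0.
Proof.
move=> a0.
have supp n K : (#|S| < #|val K| + n)%N -> (a ^+ n) K = 0.
  elim: n K => [|n IHn] K ltK.
    by move: ltK; rewrite addn0 ltnNge subset_leq_card // (valP K).
  rewrite exprS tau_coord ?a0 ?mul0r // => L KL; apply: IHn.
  by apply: leq_trans ltK _; rewrite addnS -addSn leq_add2r proper_card.
by apply/ffunP => K; rewrite supp ?ffunE // addnS ltnS leq_addl.
Qed.

Definition supported Q a := forall K, ~~ Q K -> a K = 0.

Lemma supportedD Q a b : supported Q a -> supported Q b -> supported Q (a + b).
Proof. by move=> aQ bQ K QK; rewrite ffunE aQ // bQ // addr0. Qed.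

Lemma supportedN Q a : supported Q a -> supported Q (- a).
Proof. by move=> aQ K QK; rewrite ffunE aQ // oppr0. Qed.

Lemma supportedB Q a b : supported Q a -> supported Q b -> supported Q (a - b).
Proof. by move=> aQ bQ; apply/supportedD/supportedN. Qed.

(** Every x_L occurring in x_J x_K has L conjugate into both J and K, so a downward closed [Q] spans
    a two-sided ideal. *)
Lemma supported_mul Q a b :
  (forall K L, conj_subset L K -> Q K -> Q L) ->
  supported Q a \/ supported Q b -> supported Q (a * b).
Proof.
move=> Qdown Qab L QL; rewrite mul_coordE big1 // => J _;
  rewrite big1 // => K _.
have [->|/(struct_const_gt0 hS)[LK LJ]] := posnP (struct_const J K L).
  by rewrite mulr0.
have {}LK : conj_subset L K by apply/existsP; exists 1%g; rewrite invg1 conjsg1.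
case: Qab => [aQ | bQ].
  by rewrite aQ ?mul0r //; apply: contra QL; apply: Qdown.
by rewrite bQ ?mulr0 ?mul0r //; apply: contra QL; apply: Qdown.
Qed.

Lemma conj_subset_trans : transitive (@conj_subset W S).
Proof.
move=> K J L /existsP[w JK] /existsP[v KL]; apply/existsP; exists (v * w)%g.
by rewrite invMg conjsgM; apply: subset_trans KL; rewrite conjSg.
Qed.

Lemma conj_subset_anti J K : conj_subset J K -> conj_subset K J -> conj_eq J K.
Proof.
move=> /existsP[w JK] /existsP[v KJ]; apply/existsP; exists w.
by rewrite eqEcard JK cardJg -(cardJg (val K) v^-1) subset_leq_card.
Qed.

Lemma conj_eq_sub J K : conj_eq J K -> conj_subset J K.
Proof. by case/existsP=> w /eqP JK; apply/existsP; exists w; rewrite JK. Qed.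

Lemma conj_eq_sym J K : conj_eq J K -> conj_eq K J.
Proof.
by case/existsP=> w /eqP JK; apply/existsP; exists w^-1%g; rewrite -JK conjsgK.
Qed.

Lemma conj_eq_refl J : conj_eq J J.
Proof. by apply/existsP; exists 1%g; rewrite invg1 conjsg1. Qed.

End DescentAlgebra.

(** * The idempotents *)

Section Construction.

Variables (W : finGroupType) (S : {set W}) (k : fieldType).
Variables (R : {set subS S}) (le : rel (subS S)) (c : subS S -> W).
Hypothesis hS : coxeter_system S.
Hypothesis hR : is_representatives R.
Hypothesis hle : compatible_total_order R le.
Hypothesis hc : forall K : subS S, coxeter_element K (c K).
Implicit Types (J K L : subS S) (a b g h : dalg hS k) (Q : pred (subS S)).

Local Notation P J := <<val J>>%g.
Local Notation Rq := (Rq k R c).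
Local Notation m := (mq k R le c).
Local Notation r := (@Rq_nth W S k R le c).
Local Notation M := (Mk k R le c).
Local Notation step := (@lift_step (dalg hS k)).

Lemma betaE J K : beta c J K = mark J (val K).
Proof. exact: mark_coxeter hS _ _ _ (hc K). Qed.

Lemma gammaE J : gamma k c J = (mark J (val J))%:R.
Proof. by rewrite /gamma betaE. Qed.

Lemma RqP J : reflect (J \in R /\ (mark J (val J))%:R != 0 :> k) (J \in Rq).
Proof. by rewrite inE betaE; apply: andP. Qed.

Lemma R_rep J : exists2 K, K \in R & conj_eq J K.
Proof. by have [K [[KR JK] _]] := hR J; exists K. Qed.

Lemma R_uniq J K : J \in R -> K \in R -> conj_eq J K -> J = K.
Proof.
move=> JR KR JK; have [L [_ uniqL]] := hR J.
by rewrite -(uniqL K) // (uniqL J) // conj_eq_refl.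
Qed.

Lemma tau_mark K L : (forall J, (mark J (val K))%:R =
  (mark J (val L))%:R :> k) ->
  forall a, tau K a = tau L a.
Proof. by move=> eqKL a; apply: eq_bigr => J _; rewrite eqKL. Qed.

(** If beta_KK vanishes in k, [mark_modp] replaces K by some L with larger W_L and the same
    character over k; the climb ends in R_q. *)
Lemma tau_class K : exists2 L, L \in Rq & forall a, tau K a = tau L a.
Proof.
have [n] := ubnP (#|W| - #|P K|)%N; elim: n K => // n IHn K;
  rewrite ltnS => leKn.
have [K0 K0R KK0] := R_rep K.
have tauK a : tau K a = tau K0 a.
  by apply: tau_mark => J; rewrite (mark_conj_eq hS J KK0).
have cardK : #|P K| = #|P K0|.
  by case/existsP: KK0 => w /eqP <-; rewrite genJ cardJg.
have [K00 | K0n0] := eqVneq (mark K0 (val K0))%:R (0 : k); last first.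
  by exists K0 => //; apply/RqP.
have [q qk] : exists q, q \in [pchar k].
  by apply: (natf0_pchar (mark_self hS K0)); rewrite K00.
have q_dv : (q %| mark K0 (val K0))%N by rewrite (dvdn_pcharf qk) K00.
have [L ltL eqL] := mark_modp hS (pcharf_prime qk) q_dv.
have [|L0 L0R tauL] := IHn L.
  apply: leq_trans leKn; rewrite cardK ltn_sub2l //.
  exact: leq_trans ltL (max_card _).
exists L0 => // a; rewrite tauK -tauL; apply: tau_mark => J.
by rewrite -(GRing.natr_mod_pchar qk) eqL (GRing.natr_mod_pchar qk).
Qed.

(** These elements play the part of the radical: by [tau_class] all characters kill them, so they
    are nilpotent. *)
Definition Rq_null a := forall L, L \in Rq -> tau L a = 0.

Lemma Rq_null_nilpotent a : Rq_null a -> a ^+ #|S|.+1 = 0.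
Proof.
by move=> a0; apply: tau_nilpotent => K; have [L LR ->] := tau_class K;
  apply: a0.
Qed.

Lemma idem_Rq_null a : a * a = a -> Rq_null a -> a = 0.
Proof.
move=> aa /Rq_null_nilpotent; suff -> n : a ^+ n.+1 = a by [].
by elim: n => [|n IHn]; rewrite ?expr1 // exprS IHn.
Qed.

Lemma dinfty_lift a : (forall L, L \in Rq -> tau L a * tau L a = tau L a) ->
  exists2 N, forall j, (N <= j)%N -> iter j step a = dinfty a
           & (dinfty a : dalg hS k) * (dinfty a : dalg hS k) = dinfty a.
Proof.
move=> a_idem.
have null : Rq_null (a * a - a).
  by move=> L LR; rewrite rmorphB rmorphM /= a_idem ?subrr.
have [N N_max N_idem] := lift_step_converges (Rq_null_nilpotent null).
have -> : dinfty a = iter N step a.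
  apply: classical_sets.xget_unique; first by exists N.
  move=> b [N' N'b].
  by rewrite -(N'b (maxn N N')) ?leq_maxr //; apply: N_max; apply: leq_maxl.
by exists N.
Qed.

Lemma tau_iter K a j : tau K a * tau K a = tau K a ->
  tau K (iter j step a) = tau K a.
Proof.
move=> aa; elim: j => //= j IHj.
by rewrite rmorphB !rmorphMn !rmorphM /= IHj !aa -mulrnBr.
Qed.

(** Apply [tau_class] to the parabolic closure of w: a function in the image of theta is determined
    by its values at the c_L, L in R_q. *)
Lemma theta_tau w : exists2 L, L \in Rq & forall a, theta a w = tau L a.
Proof.
have [K [y [_ eqK]]] := mark_closure hS [set w].
have [L LR tauL] := tau_class K; exists L => // a.
by rewrite ffunE -tauL; apply: eq_bigr => J _; rewrite perm_charE // eqK.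
Qed.

Lemma theta_c K a : theta a (c K) = tau K a.
Proof. by rewrite ffunE; apply: eq_bigr => J _;
  rewrite (mark_coxeter hS _ (hc K)). Qed.

Lemma tauZ K (x : k) a : tau K (x *: a : dalg hS k) = x * tau K a.
Proof. by rewrite /tau mulr_sumr; apply: eq_bigr => J _;
  rewrite ffunE -mulrA. Qed.

(** * The enumeration of R_q and the triangular matrix of marks *)

Lemma mem_Rq_seq J : (J \in Rq_seq k R le c) = (J \in Rq).
Proof. by rewrite mem_sort mem_enum. Qed.

Lemma r_Rq i : r i \in Rq.
Proof. by rewrite -mem_Rq_seq mem_tnth. Qed.

Lemma r_R i : r i \in R.
Proof. by have /RqP[] := r_Rq i. Qed.

Lemma Rq_seq_uniq : uniq (Rq_seq k R le c).
Proof. by rewrite sort_uniq enum_uniq. Qed.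

Lemma r_inj : injective r.
Proof. by apply/tuple_uniqP; apply: Rq_seq_uniq. Qed.

Lemma r_index J : J \in Rq ->
  exists2 i, J = r i & index J (Rq_seq k R le c) = i.
Proof.
rewrite -mem_Rq_seq => Js; have ltJ := Js; rewrite -index_mem in ltJ.
by exists (Ordinal ltJ) => //; rewrite /Rq_nth (tnth_nth J) nth_index.
Qed.

Lemma index_r i : index (r i) (Rq_seq k R le c) = i.
Proof. by have [j /r_inj <-] := r_index (r_Rq i). Qed.

Lemma r_conj i j : conj_eq (r i) (r j) -> i = j.
Proof. by move=> /(R_uniq (r_R i) (r_R j))/r_inj. Qed.

Lemma r_le i j : conj_subset (r j) (r i) -> (j <= i)%N.
Proof.
case: hle => le_tot le_anti le_tr le_conj ji; rewrite leqNgt;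
  apply/negP => lt_ij.
have sR : all [in R] (Rq_seq k R le c).
  by apply/allP => J; rewrite mem_Rq_seq => /RqP[].
have srt : sorted le (Rq_seq k R le c).
  by apply: (sort_sorted_in le_tot); apply/allP => J;
    rewrite mem_enum => /RqP[].
have le_ij : le (r i) (r j).
  rewrite /Rq_nth !(tnth_nth (r i)) /=.
  by apply: (sorted_ltn_nth_in le_tr (r i) sR srt); rewrite ?inE ?ltn_ord.
have le_ji := le_conj _ _ (r_R j) (r_R i) ji.
have := le_anti _ _ (r_R i) (r_R j);
  rewrite le_ij le_ji => /(_ isT)/r_inj eq_ij.
by rewrite eq_ij ltnn in lt_ij.
Qed.

Lemma ME i j : M i j = (mark (r i) (val (r j)))%:R.
Proof. by rewrite mxE betaE. Qed.

Lemma M_diag i : M i i != 0.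
Proof. by rewrite ME; have /RqP[] := r_Rq i. Qed.

Lemma M_sub i j : M i j != 0 -> conj_subset (r j) (r i).
Proof.
rewrite ME => Mij; apply: (mark_gt0 hS); rewrite lt0n;
  apply: contraNneq Mij => ->.
by rewrite eqxx.
Qed.

(** By [M_sub] and [r_le] the matrix is lower triangular, and membership in R_q makes its diagonal
    nonzero. *)
Lemma M_unit : M \in unitmx.
Proof.
rewrite unitmxE det_trig ?unitfE; first by apply/prodf_neq0 => i _;
  apply: M_diag.
apply/is_trig_mxP => i j lt_ij; apply/eqP; apply: contraLR lt_ij => /M_sub/r_le.
by rewrite leqNgt.
Qed.

Lemma invM_sum i l : \sum_j invmx M i j * M j l = (i == l)%:R.
Proof. by have /matrixP/(_ i l) := mulVmx M_unit; rewrite !mxE. Qed.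

(** Take the last column l with an offending entry in row i. In the (i, l) entry of M^-1 M, any
    other nonzero term would give a later offending column, so the diagonal term would be zero. *)
Lemma invM_sub i j : invmx M i j != 0 -> conj_subset (r j) (r i).
Proof.
move=> bij; have [//|nsub] := boolP (conj_subset (r j) (r i)); exfalso.
pose Q j := (invmx M i j != 0) && ~~ conj_subset (r j) (r i).
have Qj : Q j by apply/andP.
case: (arg_maxnP (fun j : 'I_m => val j) Qj) => l /andP[bil nsubl] max_l.
have := invM_sum i l; rewrite (bigD1 l) //= big1 => [|j' nej].
  rewrite addr0; case: eqP => [eq_il | _ /eqP].
    by rewrite eq_il (conj_eq_sub (conj_eq_refl _)) in nsubl.
  by rewrite mulf_eq0 (negbTE bil) (negbTE (M_diag l)).
apply/eqP; rewrite mulf_eq0; apply: contraR nej;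
  rewrite negb_or => /andP[bij' Mj'l].
have lj' := M_sub Mj'l.
have /max_l le_j'l : Q j'.
  by rewrite /Q bij'; apply: contra nsubl; apply: conj_subset_trans lj'.
rewrite -val_eqE eqn_leq (r_le lj') andbT; exact: le_j'l.
Qed.

Lemma invM_diag i : invmx M i i = (gamma k c (r i))^-1.
Proof.
have := invM_sum i i; rewrite (bigD1 i) //= big1 => [|j nej].
  rewrite addr0 eqxx gammaE -ME => bM; apply: (mulIf (M_diag i)).
  by rewrite bM mulVf ?M_diag.
apply/eqP; rewrite mulf_eq0; apply: contraR nej; rewrite negb_or.
case/andP=> /invM_sub ji /M_sub ij.
by apply/eqP/r_conj; apply: conj_subset_anti.
Qed.


(* The elements of the construction, seen in the ring dalg. *)
Definition df (i : 'I_m) : dalg hS k := f_ i.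
Definition df_ge n : dalg hS k := f_ge k R le c n.
Definition df_prime n : dalg hS k := f_prime k R le c n.
Definition de n : dalg hS k := df_prime n - df_prime n.+1.

Lemma dfE i : df i = \sum_j invmx M i j *: (dx k (r j) : dalg hS k).
Proof. by []. Qed.

Lemma df_geE n : df_ge n = \sum_(j < m | (n <= j)%N) df j.
Proof. by []. Qed.

Lemma tau_df i l : tau (r l) (df i) = (i == l)%:R.
Proof.
rewrite dfE raddf_sum -invM_sum /=; apply: eq_bigr => j _.
by rewrite tauZ tau_dx ME.
Qed.

Lemma tau_df_ge n l : tau (r l) (df_ge n) = (n <= l)%N%:R.
Proof.
rewrite df_geE raddf_sum /=; under eq_bigr do rewrite tau_df.
have [nl | nl] := leqP n l.
  by rewrite (bigD1 l) //= eqxx big1 ?addr0 // => j /andP[_ /negbTE ->].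
by rewrite big1 // => j nj; case: eqP => // jl; rewrite jl leqNgt nl in nj.
Qed.

Lemma mark_full A : mark (fullS S) A = 1%N.
Proof.
rewrite -(cards1 (1 : W)%g); apply: eq_card => u; rewrite inE X_full // in_set1.
by case: (u == 1%g) => //=; apply/subsetP => w _; apply: simple_gen.
Qed.

Lemma full_Rq : fullS S \in Rq.
Proof.
apply/RqP; rewrite mark_full oner_eq0; split=> //.
have [K KR /existsP[w /eqP wK]] := R_rep (fullS S).
suff <- : K = fullS S by [].
apply/val_inj/eqP; rewrite eqEcard (valP K) /=.
by rewrite -wK cardJg.
Qed.

(** The row of M indexed by S consists of ones, so the column sums of M^-1 form the unit row at S,
    and x_S = 1. *)
Lemma sum_df : \sum_i df i = 1.
Proof.
have [i0 eq_i0 _] := r_index full_Rq.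
have row_inv : const_mx 1 *m invmx M = delta_mx 0 i0 :> 'rV_m.
  apply: (canLR (mulmxK M_unit)); apply/rowP => l.
  by rewrite -rowE !mxE betaE -eq_i0 mark_full.
under eq_bigr do rewrite dfE; rewrite exchange_big /=.
rewrite (bigD1 i0) //= [X in _ + X]big1 => [|j nej]; rewrite -scaler_suml.
  have /matrixP/(_ 0 i0) := row_inv; rewrite !mxE !eqxx /=.
  under eq_bigr do rewrite mxE mul1r.
  by move=> ->; rewrite scale1r addr0 -eq_i0 -[RHS]/(d1 S k) d1E.
have /matrixP/(_ 0 j) := row_inv; rewrite !mxE (negbTE nej) andbF.
under eq_bigr do rewrite mxE mul1r.
by move=> ->; rewrite scale0r.
Qed.

Lemma df_primeP n : [/\ df_prime n * df_prime n = df_prime n,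
  forall l, tau (r l) (df_prime n) = (n <= l)%N%:R,
  df_prime n * df_prime n.+1 = df_prime n.+1,
  df_prime n.+1 * df_prime n = df_prime n.+1 &
  exists N, forall j, (N <= j)%N ->
    iter j step (df_prime n * df_ge n.+1 * df_prime n) = df_prime n.+1].
Proof.
have tau_a (g : dalg hS k) i l : (forall l, tau (r l) g = (i <= l)%N%:R) ->
    tau (r l) (g * df_ge i.+1 * g) = (i < l)%N%:R.
  move=> gE; rewrite !rmorphM /= !gE tau_df_ge; case: (ltnP i l) => [il | _].
    by rewrite ltnW // !mulr1.
  by rewrite mulr0 mul0r.
have main i : df_prime i * df_prime i = df_prime i ->
  (forall l, tau (r l) (df_prime i) = (i <= l)%N%:R) ->
    exists2 N, forall j, (N <= j)%N ->
      iter j step (df_prime i * df_ge i.+1 * df_prime i) = df_prime i.+1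
            & df_prime i.+1 * df_prime i.+1 = df_prime i.+1.
  move=> gg gE.
  have [|N HN idem] := @dinfty_lift (df_prime i * df_ge i.+1 * df_prime i).
    move=> L /r_index[l -> _]; rewrite tau_a //.
    by case: (i < l)%N; rewrite ?mulr1 ?mulr0.
  suff eq_fp : df_prime i.+1 = dinfty (df_prime i * df_ge i.+1 * df_prime i).
    by exists N; rewrite eq_fp.
  (* Past the last position the definition gives 0, which is also the limit of the iteration, as the
     sum [df_ge i.+1] is then empty. *)
  rewrite /df_prime /=; case: ltnP => // le_mi.
  have a0 : df_prime i * df_ge i.+1 * df_prime i = 0.
    rewrite df_geE big_pred0 ?mulr0 ?mul0r // => j; apply: negbTE;
      rewrite -ltnNge.
    exact: leq_trans (ltn_ord j) _.
  rewrite a0 in HN *; rewrite -(HN N) //.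
  by elim: N {HN} => //= N <-; rewrite /lift_step !mul0r !mul0rn subrr.
have spec : df_prime n * df_prime n = df_prime n /\
    forall l, tau (r l) (df_prime n) = (n <= l)%N%:R.
  elim: n => [|n [gg gE]]; first by rewrite mulr1; split=> // l;
    rewrite rmorph1.
  have [N HN idem] := main n gg gE; split=> // l.
  rewrite -(HN N) // tau_iter tau_a //.
  by case: (n < l)%N; rewrite ?mulr1 ?mulr0.
have [gg gE] := spec; have [N HN idem] := main n gg gE.
have [] := @iter_lift_corner _ (df_prime n)
  (df_prime n * df_ge n.+1 * df_prime n) N.
- by rewrite !mulrA gg.
- by rewrite -!mulrA gg.
by rewrite HN // => ga ag; split=> //; exists N.
Qed.

Lemma df_prime_mul i j : (i <= j)%N ->
  df_prime i * df_prime j = df_prime j /\ df_prime j * df_prime i = df_prime j.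
Proof.
move/subnK <-; elim: (j - i)%N => [|n [IH1 IH2]]; first by case: (df_primeP i).
have [_ _ ga ag _] := df_primeP (n + i).
by rewrite addSn; split; [rewrite -ga mulrA IH1 | rewrite -ag -mulrA IH2].
Qed.

Lemma de_orth i j : (i < j)%N -> de i * de j = 0 /\ de j * de i = 0.
Proof.
move=> ij; have [a1 a2] := df_prime_mul (ltnW ij);
  have [b1 b2] := df_prime_mul (leqW (ltnW ij)).
have [c1 c2] := df_prime_mul ij; have [d1 d2] := df_prime_mul (leqW ij).
rewrite /de !(mulrBl, mulrBr) !(a1, a2, b1, b2, c1, c2, d1, d2).
by rewrite !subrr.
Qed.

Lemma de_idem i : de i * de i = de i.
Proof.
have [a1 _] := df_prime_mul (leqnn i); have [b1 b2] := df_prime_mul (leqnSn i).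
have [c1 _] := df_prime_mul (leqnn i.+1).
by rewrite /de !(mulrBl, mulrBr) !(a1, b1, b2, c1) subrr subr0.
Qed.

Lemma tau_de i l : tau (r l) (de i) = (i == l :> nat)%:R.
Proof.
have [_ gE _ _ _] := df_primeP i; have [_ gE' _ _ _] := df_primeP i.+1.
rewrite rmorphB /= gE gE'; case: ltngtP => _ /=; by rewrite ?subrr ?subr0.
Qed.

(** S belongs to R_q, so m is positive and the value is the 0 of the last clause, not the initial
    1. *)
Lemma df_prime_last : df_prime m = 0.
Proof.
have [i0 _ _] := r_index full_Rq; have := leq_ltn_trans (leq0n i0) (ltn_ord i0).
by rewrite /df_prime; case Em: m => [|m'] //= _; rewrite Em ltnn.
Qed.

Lemma sum_de n : \sum_(i < n) de i = 1 - df_prime n.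
Proof.
rewrite -(big_mkord xpredT (fun i => de i)).
elim: n => [|n IHn]; first by rewrite big_geq ?subrr.
by rewrite big_nat_recr //= IHn /de addrA subrK.
Qed.

Lemma sum_Rq (V : nmodType) (F : subS S -> V) :
  \sum_(J in Rq) F J = \sum_(i < m) F (r i).
Proof.
rewrite -big_enum /= -(perm_big _ (permEl (perm_sort le (enum Rq)))) /=.
rewrite -[sort le _]/(Rq_seq k R le c) -[in LHS](in_tupleE (Rq_seq k R le c)).
by rewrite big_tuple.
Qed.


(** * Supports and leading terms of the idempotents *)

Lemma conj_subset_refl J : conj_subset J J.
Proof. exact/conj_eq_sub/conj_eq_refl. Qed.

Lemma supported_sum (I : finType) (p : pred I) (F : I -> dalg hS k) Q :
  (forall i, p i -> supported Q (F i)) -> supported Q (\sum_(i | p i) F i).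
Proof.
move=> FQ; elim/big_ind: _ => // [K _ | a b]; first by rewrite ffunE.
exact: supportedD.
Qed.

Lemma df_supported i : supported (fun K => conj_subset K (r i)) (df i).
Proof.
move=> K nKi; rewrite dfE sum_ffunE big1 // => j _; rewrite ffunE dx_E.
have [-> | b0] := eqVneq (invmx M i j) 0; first exact: mul0r.
by case: eqP => [Kj | _]; [rewrite Kj (invM_sub b0) in nKi | apply: scaler0].
Qed.

(** The iteration is polynomial, hence respects congruence modulo the ideal spanned by [Q]. *)
Lemma step_supported Q a b j : (forall K L, conj_subset L K -> Q K -> Q L) ->
  supported Q (a - b) -> supported Q (iter j step a - iter j step b).
Proof.
move=> Qdown abQ; elim: j => //= j;
  move: (iter j _ a) (iter j _ b) => {a b abQ} a b abQ.
have mulQ (x y z t : dalg hS k) : supported Q (x - y) -> supported Q (z - t) ->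
    supported Q (x * z - y * t).
  move=> xy zt; have -> : x * z - y * t = (x - y) * z + y * (z - t).
    by rewrite mulrBl mulrBr addrA subrK.
  by apply: supportedD; apply: supported_mul => //; [left | right].
have ab2 := mulQ _ _ _ _ abQ abQ.
have ab3 := mulQ _ _ _ _ ab2 abQ.
have -> : step a - step b = (a * a - b * b) *+ 3 - (a * a * a - b * b * b) *+ 2.
  by rewrite /lift_step !mulrnBl !opprB addrACA [in RHS]addrACA (addrC (- _)).
apply: supportedB => K QK; first by rewrite ffunMnE ab2 ?mul0rn.
by rewrite ffunMnE ab3 ?mul0rn.
Qed.

(** As the f_l sum to 1, the element h displayed here and the one defining f'_(i+1) add up to f'_i;
    [iter_lift_compl] passes from one limit to the other. *)
Lemma de_iter i : exists N, forall j, (N <= j)%N ->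
  de i = iter j step
    (df_prime i * (\sum_(l < m | (l <= i)%N) df l) * df_prime i).
Proof.
have [gg _ _ _ [N HN]] := df_primeP i; exists N => j lej.
set h := df_prime i * _ * df_prime i.
have hE : df_prime i * df_ge i.+1 * df_prime i = df_prime i - h.
  apply/eqP; rewrite eq_sym subr_eq -mulrDl -mulrDr df_geE.
  have gE : df_prime i = df_prime i * 1 * df_prime i by rewrite mulr1 gg.
  rewrite {1}gE -sum_df; apply/eqP; congr (_ * _ * _).
  rewrite (bigID (fun l : 'I_m => (i < l)%N)) /=; congr (_ + _).
  by apply: eq_bigl => l; rewrite -leqNgt.
have gh : df_prime i * h = h by rewrite /h !mulrA gg.
have hg : h * df_prime i = h by rewrite /h -!mulrA gg.
by rewrite /de -(HN j lej) hE iter_lift_compl // opprB addrC subrK.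
Qed.

Lemma iter_Rq_null a : Rq_null a -> exists N, forall j, (N <= j)%N ->
  iter j step a = 0.
Proof.
move=> a0; have [|N HN idem] := @dinfty_lift a.
  by move=> L LR; rewrite a0 ?mul0r.
exists N => j lej; rewrite HN // (idem_Rq_null idem) // => L LR.
by rewrite -(HN N) // tau_iter a0 ?mul0r.
Qed.

Lemma sum_df_le (i : 'I_m) :
  \sum_(l < m | (l <= i)%N) df l = df i + \sum_(l < m | (l < i)%N) df l.
Proof.
rewrite (bigD1 i) //=; congr (_ + _); apply: eq_bigl => l.
by rewrite ltn_neqAle andbC.
Qed.

Lemma de_supported (i : 'I_m) : supported (fun K => conj_subset K (r i)) (de i).
Proof.
have [N HN] := de_iter i.
pose rad := df_prime i * (\sum_(l < m | (l < i)%N) df l) * df_prime i.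
(* At a position l < i the factor f'_i has value 0; at l >= i all the f_j with j < i have value
   0. *)
have rad0 : Rq_null rad.
  move=> L /r_index[l -> _]; have [_ gE _ _ _] := df_primeP i.
  rewrite !rmorphM raddf_sum /= !gE; case: (leqP i l) => il;
    last by rewrite !mul0r.
  rewrite big1 ?mulr0 ?mul0r // => j ji; rewrite tau_df.
  by case: eqP => // jl; rewrite jl ltnNge il in ji.
have [N' HN'] := iter_Rq_null rad0.
have Qdown : forall K L, conj_subset L K -> conj_subset K (r i) ->
  conj_subset L (r i).
  by move=> K L LK; apply: conj_subset_trans.
rewrite (HN (maxn N N')) ?leq_maxl // sum_df_le mulrDr mulrDl -/rad.
rewrite -[iter _ _ _]subr0 -(HN' (maxn N N')) ?leq_maxr //.
apply: step_supported => //; rewrite addrK.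
by do 2![apply: supported_mul => //; (left + right)]; apply: df_supported.
Qed.

(** The coefficient of v v at r_i is gamma^-2 gamma. Elsewhere only subsets of r_i occur, and a
    subset conjugate to r_i equals it by cardinality. *)
Lemma dx_mul_self i (v := (gamma k c (r i))^-1 *: (dx k (r i) : dalg hS k)) :
  supported (fun K => conj_proper K (r i)) (v * v - v).
Proof.
move=> K; rewrite negb_and negbK ffunE [(- v) K]ffunE.
have vE : v * v = (gamma k c (r i))^-1 *: (v * (dx k (r i) : dalg hS k)).
  apply/ffunP => L; rewrite ffunE !mul_coordE scaler_sumr;
    apply: eq_bigr => J _.
  rewrite scaler_sumr; apply: eq_bigr => J' _; rewrite [X in _ * X * _]ffunE.
  by rewrite -!mulrA mulrCA.
have [-> _|neKi nKi] := eqVneq K (r i).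
  rewrite vE ffunE -tau_coord_dx tauZ tau_dx gammaE mulVf; last first.
    by have /RqP[] := r_Rq i.
  by rewrite [v _]ffunE dx_E eqxx gammaE subrr.
have -> : v K = 0 by rewrite ffunE dx_E (negbTE neKi) scaler0.
rewrite subr0 vE ffunE; have [-> | /mul_dx_supp Ki] :=
  eqVneq ((v * (dx k (r i) : dalg hS k)) K) 0.
  exact: scaler0.
have {}Ki' : conj_subset K (r i) by apply/existsP; exists 1%g;
  rewrite invg1 conjsg1.
rewrite Ki' /= in nKi; case/existsP: nKi => w /eqP Kw.
case/eqP: neKi; apply/val_inj/eqP.
by rewrite eqEcard Ki -Kw cardJg leqnn.
Qed.

Lemma conj_proper_down J K L : conj_subset L K -> conj_proper K J ->
  conj_proper L J.
Proof.
move=> LK /andP[KJ nKJ]; rewrite /conj_proper (conj_subset_trans LK KJ) /=.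
apply: contra nKJ => /conj_eq_sym/conj_eq_sub JL.
by apply: conj_subset_anti => //; apply: conj_subset_trans LK.
Qed.

Lemma df_lead i :
  supported (fun K => conj_proper K (r i))
    (df i - (gamma k c (r i))^-1 *: dx k (r i)).
Proof.
rewrite dfE (bigD1 i) //= invM_diag addrAC subrr add0r.
apply: supported_sum => j neji K nK; rewrite ffunE dx_E.
have [-> | /invM_sub ji] := eqVneq (invmx M i j) 0; first exact: mul0r.
case: eqP => [eqK | _]; last exact: scaler0.
move: nK; rewrite eqK /conj_proper ji negbK => /r_conj eqji.
by rewrite eqji eqxx in neji.
Qed.

Lemma de_lead (i : 'I_m) :
  supported (fun K => conj_proper K (r i))
    (de i - (gamma k c (r i))^-1 *: dx k (r i)).
Proof.
set v : dalg hS k := _ *: _.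
(* The ideal of [Q] contains 1 - f'_i, the sum of the e_j with j < i, so modulo it the factors f'_i
   drop out and the starting point becomes v, which is idempotent there. *)
pose Q K := conj_proper K (r i) ||
  [exists j : 'I_m, (j < i)%N && conj_subset K (r j)].
have Qdown K L : conj_subset L K -> Q K -> Q L.
  move=> LK /orP[/(conj_proper_down LK) Li | /existsP[j /andP[ji Kj]]].
    by rewrite /Q Li.
  apply/orP; right; apply/existsP; exists j; rewrite ji.
  exact: conj_subset_trans LK Kj.
have lowQ (a : dalg hS k) : supported (fun K => conj_proper K (r i)) a ->
  supported Q a.
  by move=> aP K; rewrite negb_or => /andP[nK _]; apply: aP.
have leftQ (j : 'I_m) (a : dalg hS k) : (j < i)%N ->
    supported (fun K => conj_subset K (r j)) a -> supported Q a.
  move=> ji aj K; rewrite negb_or => /andP[_ /existsPn/(_ j)]; rewrite ji /=.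
  exact: aj.
have gQ : supported Q (1 - df_prime i).
  rewrite -sum_de (big_ord_widen m (fun n => de n) (ltnW (ltn_ord i))).
  by apply: supported_sum => j ji; apply: (leftQ j) => //; apply: de_supported.
have [N HN] := de_iter i.
have hQ : supported Q
    (df_prime i * (\sum_(l < m | (l <= i)%N) df l) * df_prime i - v).
  rewrite sum_df_le; set b := \sum_(_ < m | _) _.
  have bQ : supported Q b.
    by apply: supported_sum => l li; apply: (leftQ l) => //;
      apply: df_supported.
  have -> : df_prime i * (df i + b) * df_prime i
      = df i + b - (1 - df_prime i) * (df i + b)
        - df_prime i * (df i + b) * (1 - df_prime i).
    by rewrite mulrBr mulr1 mulrBl mul1r !subKr.
  rewrite !(addrAC _ _ (- v)).
  do 2?apply: supportedB; last by apply: supported_mul => //; right.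
    by apply: supportedD => //; apply/lowQ/df_lead.
  by apply: supported_mul => //; left.
have v2Q : supported Q (v * v - v) by apply/lowQ/dx_mul_self.
have v3Q : supported Q (v * v * v - v).
  rewrite -(subrK (v * v) (v * v * v)) -addrA; apply: supportedD => //.
  by rewrite -mulrBl; apply: supported_mul => //; left.
have vQ j : supported Q (iter j step v - v).
  elim: j => [|j IHj]; first by move=> K _; rewrite subrr ffunE.
  rewrite -(subrK (iter j step v) (iter j.+1 step v)) -addrA;
    apply: supportedD => //.
  rewrite iterSr; apply: step_supported => //.
  have -> : step v - v = (v * v - v) *+ 3 - (v * v * v - v) *+ 2.
    by apply/ffunP => K; rewrite /lift_step !ffunE; ring.
  by apply: supportedB => K QK; rewrite ffunMnE ?v2Q ?v3Q ?mul0rn.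
have evQ : supported Q (de i - v).
  have -> : de i - v =
    (de i - iter N step v) + (iter N step v - v) by rewrite addrA subrK.
  by apply: supportedD => //; rewrite (HN N) //; apply: step_supported.
(* Outside the conjugates into r_i both terms vanish. A K conjugate to r_i itself is outside [Q],
   since r_i is conjugate into no r_j with j < i. *)
move=> K nK; have [Ki | nKi] := boolP (conj_subset K (r i)); last first.
  rewrite ffunE de_supported // add0r 2!ffunE dx_E.
  case: eqP => [eqK | _]; last by rewrite scaler0 oppr0.
  by rewrite eqK conj_subset_refl in nKi.
apply: evQ; rewrite negb_or nK; apply/existsPn => j; apply/negP => /andP[ji Kj].
move: nK; rewrite /conj_proper Ki negbK => /conj_eq_sym/conj_eq_sub iK.
by have := r_le (conj_subset_trans iK Kj); rewrite leqNgt ji.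
Qed.


(** * Coefficients in the prime subfield *)

Section Subfield.

Variable F : divringClosed k.

Lemma det_closed n (A : 'M[k]_n) : (forall i j, A i j \in F) -> \det A \in F.
Proof.
move=> AF; apply: rpred_sum => s _; rewrite rpredMsign.
by apply: rpred_prod => i _; apply: AF.
Qed.

(** By the adjugate formula; for a singular A, [invmx A] is A itself. *)
Lemma invmx_closed n (A : 'M[k]_n) i j :
  (forall i j, A i j \in F) -> invmx A i j \in F.
Proof.
move=> AF; rewrite /invmx; case: ifP => // _; rewrite mxE.
rewrite rpredM ?rpredV ?det_closed // mxE rpredMsign det_closed // => i' j'.
by rewrite !mxE.
Qed.

Definition defined_over a := forall K, a K \in F.

Lemma defined_overB a b : defined_over a -> defined_over b ->
  defined_over (a - b).
Proof. by move=> aF bF K; rewrite ffunE [(- b) K]ffunE rpredB. Qed.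

Lemma defined_overM a b : defined_over a -> defined_over b ->
  defined_over (a * b).
Proof.
move=> aF bF K; rewrite mul_coordE; do 2!apply: rpred_sum => ? _.
by rewrite !rpredM ?rpred_nat.
Qed.

Lemma defined_over_iter a j : defined_over a -> defined_over (iter j step a).
Proof.
move=> aF; elim: j => //= j IHj; apply: defined_overB => K;
  rewrite ffunMnE rpredMn //.
  exact: defined_overM.
by do !apply: defined_overM.
Qed.

Lemma defined_over_df i : defined_over (df i).
Proof.
move=> K; rewrite dfE sum_ffunE rpred_sum // => j _.
rewrite ffunE dx_E rpredM ?rpred_nat // invmx_closed // => i' j'.
by rewrite ME rpred_nat.
Qed.

(** Each f'_(n+1) is reached after finitely many steps, and the structure constants are natural
    numbers. *)
Lemma defined_over_df_prime n : defined_over (df_prime n).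
Proof.
elim: n => [|n IHn]; first by move=> K;
  rewrite /df_prime /= (d1E hS) ffunE rpred_nat.
have [_ _ _ _ [N HN]] := df_primeP n; rewrite -(HN N) //.
apply: defined_over_iter; do !apply: defined_overM => //.
by move=> K; rewrite df_geE sum_ffunE rpred_sum // => j _;
  apply: defined_over_df.
Qed.

Lemma defined_over_de n : defined_over (de n).
Proof. exact/defined_overB/defined_over_df_prime/defined_over_df_prime. Qed.

End Subfield.

(** * Primitivity and the values of theta *)

Lemma e_de J i : index J (Rq_seq k R le c) = i -> e_ k R le c J = de i.
Proof. by rewrite /e_ => ->. Qed.

(** One of b, b' has value 0 at r_i, as their product is 0. It also vanishes at the other positions,
    being a multiple of e_i, so it is a nilpotent idempotent. *)
Lemma de_indecomposable (i : 'I_m) (b b' : dalg hS k) : b * b = b ->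
  b' * b' = b' ->
  b * b' = 0 -> b' * b = 0 -> de i = b + b' -> b = 0 \/ b' = 0.
Proof.
move=> bb b'b' bb' b'b eE.
have ei : tau (r i) (de i) = 1 by rewrite tau_de eqxx.
have be : b * de i = b by rewrite eE mulrDr bb bb' addr0.
have b'de : b' * de i = b' by rewrite eE mulrDr b'b' b'b add0r.
have null (x : dalg hS k) : x * x = x -> x * de i = x -> tau (r i) x = 0 ->
  x = 0.
  move=> xx xe x0; apply: idem_Rq_null => // L /r_index[l -> _].
  have [<- //|neil] := eqVneq i l.
  by rewrite -xe rmorphM /= tau_de val_eqE (negbTE neil) mulr0.
have : tau (r i) b * tau (r i) b' = 0 by rewrite -rmorphM bb' rmorph0.
by move/eqP; rewrite mulf_eq0 => /orP[/eqP b0 | /eqP b0]; [left | right];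
  apply: null.
Qed.

Lemma de_primitive (i : 'I_m) : dprimitive (de i).
Proof.
split=> [|e0|b b' bb b'b' [bb' b'b]]; first exact: de_idem.
  have := tau_de i i; rewrite e0 rmorph0 eqxx => /esym/eqP.
  by rewrite oner_eq0.
exact: (@de_indecomposable i b b').
Qed.

(** Uniqueness of the function selected by [xget] comes from [theta_tau]. *)
Lemma theta_de (i : 'I_m) : theta (de i : descent S k) = char_ k R c (r i).
Proof.
apply/esym; apply: classical_sets.xget_unique.
  split; first by exists (de i).
    by rewrite (theta_c _ (de i)) tau_de eqxx.
  move=> L /r_index[l -> _] neli; rewrite (theta_c _ (de i)) tau_de.
  by case: eqP => // /val_inj eq_il; rewrite eq_il eqxx in neli.
move=> _ [[a ->] a1 a0]; apply/ffunP => w.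
have [L /r_index[l -> _] thetaE] := theta_tau w.
rewrite (thetaE a) (thetaE (de i)) tau_de;
  case: eqP => [/val_inj <- | /eqP neil].
  by rewrite -theta_c a1.
rewrite -theta_c a0 ?r_Rq //; apply: contra neil => /eqP/r_inj ->; exact: eqxx.
Qed.

Lemma de_expansion (i : 'I_m) : exists epsilon : subS S -> k,
  (forall K, conj_proper K (r i) -> in_prime_subfield (epsilon K)) /\
  de i = (gamma k c (r i))^-1 *: dx k (r i)
        + \sum_(K | conj_proper K (r i)) epsilon K *: dx k K.
Proof.
(* The coefficients are those of e_i itself; they lie in every divring-closed subset of k. *)
exists (de i); split=> [K _ F hF | ].
  pose F' : divringClosed k := HB.pack F (GRing.isDivringClosed.Build k F hF).
  exact: (defined_over_de F').
apply/ffunP => K; rewrite [RHS]ffunE sum_ffunE;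
  have [Ki | nKi] := boolP (conj_proper K (r i)).
  rewrite (bigD1 K) //= big1 => [|L /andP[_ neLK]]; rewrite !ffunE; last first.
    by rewrite eq_sym (negbTE neLK) scaler0.
  have -> : (K == r i) = false.
    by apply/eqP => eqK; move: Ki; rewrite eqK /conj_proper conj_eq_refl andbF.
  by rewrite eqxx scaler0 add0r addr0 -[_ *: _]/(_ * _) mulr1.
rewrite big1 => [|L Li]; last first.
  by rewrite !ffunE; case: eqP => [eqK|];
    [rewrite -eqK (negbTE nKi) in Li | rewrite scaler0].
rewrite addr0 -[de i](subrK ((gamma k c (r i))^-1 *: dx k (r i))) [LHS]ffunE.
by rewrite (de_lead nKi) add0r.
Qed.

End Construction.

Theorem theorem8p7 (W : finGroupType) (S : {set W}) (k : fieldType)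
    (R : {set subS S}) (le : rel (subS S)) (c : subS S -> W)
    (hS : coxeter_system S)
    (hR : is_representatives R)
    (hle : compatible_total_order R le)
    (hc : forall K : subS S, coxeter_element K (c K)) :
  [/\ complete_orthogonal_primitive (Rq k R c) (e_ k R le c),
      {in Rq k R c, forall J, theta (e_ k R le c J) = char_ k R c J},
      \sum_(J in Rq k R c) e_ k R le c J = d1 S k &
      {in Rq k R c, forall J,
        exists epsilon : subS S -> k,
          (forall K, conj_proper K J -> in_prime_subfield (epsilon K)) /\
          e_ k R le c J =
            (gamma k c J)^-1 *: dx k J
            + \sum_(K | conj_proper K J) epsilon K *: dx k K}].
Proof.
have sumE : \sum_(J in Rq k R c) e_ k R le c J = d1 S k.
  rewrite (@sum_Rq W S k R le c);
    under eq_bigr do rewrite (e_de hS (index_r _)).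
  by rewrite -[LHS]/(\sum_(i < mq k R le c) de k R le c hS i) sum_de
    df_prime_last // subr0.
split=> //.
- split=> // [J /(r_index le)[i -> eq_i] |
    J L /(r_index le)[i -> eq_i] /(r_index le)[j -> eq_j]].
    by rewrite (e_de hS eq_i); apply: de_primitive.
  rewrite (e_de hS eq_i) (e_de hS eq_j) => neij.
  have [ij | ji | /val_inj eq_ij] := ltngtP i j.
  + by have [] := de_orth k hS hR hle hc ij.
  + by have [] := de_orth k hS hR hle hc ji.
  + by rewrite eq_ij eqxx in neij.
- by move=> J /(r_index le)[i -> eq_i]; rewrite (e_de hS eq_i); apply: theta_de.
- by move=> J /(r_index le)[i -> eq_i]; rewrite (e_de hS eq_i);
  apply: de_expansion.
Qed.
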